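(* The differential operator $\mathcal L u=[\kappa_j(x)u_x]_x$ (on each $\mathbb X_j$) on $\mathbb L$, subject to the edge conditions, for every $j$, $$(1-\tfrac12\gamma)(u_j^R-u_j^L)=\tfrac12\gamma(u_{j+1}^L-u_{j-1}^R)+\tfrac12\gamma\theta(u_j^L+u_j^R)-\tfrac12\gamma\theta(u_{j+1}^L+u_{j-1}^R),$$ $$(1-\tfrac12\gamma)(f_j^R-f_j^L)=\tfrac12\gamma(f_{j+1}^L-f_{j-1}^R)-\tfrac12\gamma\theta(f_j^L+f_j^R)+\tfrac12\gamma\theta(f_{j+1}^L+f_{j-1}^R),$$ where $f_j:=-\kappa_j(x)u_{jx}$, and in the usual inner product $\langle\tilde u,u\rangle:=\sum_{j=1}^N\int_{\mathbb X_j}\tilde u_ju_j\,dx$, is self-adjoint for almost every real $\gamma$ and $\theta$; the only exception being the isolated case when $N$ is even, $\gamma=1$ and $\theta=0$.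
   Context: The spatial domain $\mathbb X$ is an interval of length $\mathfrak L$, with $\mathfrak L$-periodic boundary conditions, partitioned into $N$ disjoint abutting open intervals (elements) $\mathbb X_j=(L_j,R_j)$, $R_j=L_{j+1}$, indices modulo $N$ (so $u^{e}_{j+N}=u^{e}_j$, $f^{e}_{j+N}=f^{e}_j$ for $e\in\{L,R\}$). $\mathbb L$ denotes the space of square integrable, twice differentiable, $\mathfrak L$-periodic functions, considered on $\bigcup_j\mathbb X_j$ (fields may be discontinuous between elements); $u_j$ denotes $u$ restricted to $\mathbb X_j$. Superscripts $R,L$ denote evaluation (as a limit from within the relevant element) at its right and left edges, e.g. $u_{j-1}^R=u_{j-1}(R_{j-1})$, $u_{j+1}^L=u_{j+1}(L_{j+1})$. The diffusivities are $\kappa_j(x):=-\frac{\partial f}{\partial u_x}(x,U_j,0)$ for constants $U_j$, where $f(x,u,u_x)$ is a smooth function with $\partial f/\partial u_x\le-\nu<0$ for some $\nu>0$ and $f(x,u,0)=0$; in particular $\kappa_j$ is smooth and $\kappa_j(x)\ge\nu>0$. *)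

(* Defs.v *)
From HB Require Import structures.
From mathcomp Require Import all_boot all_order all_algebra.
From mathcomp Require Import all_classical all_reals all_analysis.

Set Implicit Arguments.
Unset Strict Implicit.
Unset Printing Implicit Defensive.

Import Order.TTheory GRing.Theory Num.Theory.
Import numFieldNormedType.Exports.

Local Open Scope ring_scope.
Local Open Scope classical_set_scope.

Section Smooth.
Variable R : realType.

Definition iter_derive (s : seq (R * R * R)) (f : R * R * R -> R) :
  R * R * R -> R := foldr (fun v g p => 'D_v g p) f s.

(* C^oo on R^3: the iterated directional derivatives of every order, in all
   directions, exist everywhere and are jointly continuous. *)
Definition smooth (f : R * R * R -> R) : Prop :=
  forall s : seq (R * R * R),
    continuous (iter_derive s f) /\
    (forall p v, derivable (iter_derive s f) p v).

(* The arguments of f are (x, u, u_x). *)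
Definition d_ux (f : R * R * R -> R) (p : R * R * R) : R :=
  'D_((0, 0, 1) : R * R * R) f p.

Definition diffusivity (N : nat) (f : R * R * R -> R) (U : 'I_N -> R)
  (j : 'I_N) (y : R) : R := - d_ux f (y, U j, 0).

End Smooth.

Section PatchOperator.
Variables (R : realType) (ell : R) (N : nat).

(* The elements are X_j = ]x j, x j.+1[ for j < N; as x N = x 0 + ell, the node
   x N is the same point of the ell-periodic domain as x 0, which is why edge
   values are indexed cyclically below (ordS j and ord_pred j are j + 1 and
   j - 1 modulo N). *)
Variable x : nat -> R.
Variable kappa : 'I_N -> R -> R.

Notation mu := (@lebesgue_measure R).

Definition elt (j : 'I_N) : interval R := `]x j, x j.+1[%R.

Definition square_integrable (u : R -> R) : Prop := forall j : 'I_N,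
  measurable_fun [set` elt j] u /\
  mu.-integrable [set` elt j] (fun y => (u y ^+ 2)%:E).

Definition twice_differentiable (u : R -> R) : Prop :=
  forall (j : 'I_N) (y : R), y \in elt j ->
    derivable u y 1 /\ derivable (derive1 u) y 1.

(* The values at the nodes are irrelevant and u may jump there. *)
Definition LL : set (R -> R) := [set u |
  [/\ periodic u ell, square_integrable u & twice_differentiable u]].

Definition inner (v u : R -> R) : R :=
  \sum_(j < N) \int[mu]_(y in [set` elt j]) (v y * u y).

(* The elements are disjoint, so at most one term is selected. *)
Definition Lop (u : R -> R) (y : R) : R :=
  \sum_(j < N | y \in elt j) derive1 (fun z => kappa j z * derive1 u z) y.

Definition flux (u : R -> R) (j : 'I_N) (y : R) : R :=
  - (kappa j y * derive1 u y).

Definition edgeL (g : 'I_N -> R -> R) (j : 'I_N) : R :=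
  lim (g j y @[y --> (x j)^'+]).
Definition edgeR (g : 'I_N -> R -> R) (j : 'I_N) : R :=
  lim (g j y @[y --> (x j.+1)^'-]).
Definition has_edge_values (g : 'I_N -> R -> R) : Prop :=
  forall j : 'I_N, cvg (g j y @[y --> (x j)^'+]) /\
                   cvg (g j y @[y --> (x j.+1)^'-]).

Definition edge_conditions (gamma theta : R) (u : R -> R) : Prop :=
  let uL := edgeL (fun=> u) in let uR := edgeR (fun=> u) in
  let fL := edgeL (flux u) in let fR := edgeR (flux u) in
  forall j : 'I_N,
    (1 - gamma / 2) * (uR j - uL j) =
      gamma / 2 * (uL (ordS j) - uR (ord_pred j))
      + gamma / 2 * theta * (uL j + uR j)
      - gamma / 2 * theta * (uL (ordS j) + uR (ord_pred j))
    /\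
    (1 - gamma / 2) * (fR j - fL j) =
      gamma / 2 * (fL (ordS j) - fR (ord_pred j))
      - gamma / 2 * theta * (fL j + fR j)
      + gamma / 2 * theta * (fL (ordS j) + fR (ord_pred j)).

(* Twice differentiability alone does not make L u square integrable, so this
   is required for <v, L u> to be defined. *)
Definition domL (gamma theta : R) : set (R -> R) := [set u |
  [/\ LL u, square_integrable (Lop u),
      has_edge_values (fun=> u), has_edge_values (flux u) &
      edge_conditions gamma theta u]].

(* A = A^* as operators on LL: a field v of LL is in the domain of the adjoint,
   with A^* v = w, iff v is in the domain of A and A v = w almost everywhere.
   Right to left this is the symmetry <v, A u> = <A v, u> on the domain; left
   to right, the adjoint has no larger domain.  Thus the adjoint is taken in
   the inner product space LL (with images in L^2), not in its completion. *)
Definition self_adjoint (dom : set (R -> R)) (A : (R -> R) -> R -> R) : Prop :=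
  forall v w : R -> R, LL v -> square_integrable w ->
    (forall u, dom u -> inner v (A u) = inner w u) <->
    (dom v /\ forall j : 'I_N, {ae mu, forall y, y \in elt j -> A v y = w y}).

End PatchOperator.

(* Main.v *)
Require Import Defs.
From HB Require Import structures.
From mathcomp Require Import all_boot all_order all_algebra.
From mathcomp Require Import all_classical all_reals all_analysis.
From mathcomp Require Import interval_inference measurable_realfun.
From mathcomp Require Import ring lra.

Set Implicit Arguments.
Unset Strict Implicit.
Unset Printing Implicit Defensive.

Import Order.TTheory GRing.Theory Num.Theory.
Import numFieldNormedType.Exports.

Local Open Scope ring_scope.
Local Open Scope classical_set_scope.

(** Integrating by parts, <v, L u> - <L v, u> is a sum of products of edge values
    and edge fluxes.  Since L u is only square integrable, this uses the
    fundamental theorem of calculus for functions that are everywhere derivable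
    with an integrable, possibly discontinuous derivative.

    With p = gamma (1 + theta) / 2 and q = gamma (1 - theta) / 2 the edge
    conditions read A uR = B uL and B^T fR = A^T fL, where A = (1 - p) + p T^-1
    and B = (1 - q) + q T are commuting circulant matrices, T being the cyclic
    shift.  If A or B is invertible then <uR, fR> = <uL, fL>, so L is symmetric.
    A is singular only if p = 1/2 and N is even, and likewise B with q, whence the
    exceptional case; there u^R_j = (-1)^j breaks the symmetry.

    Conversely, let <v, L u> = <w, u> for all u in the domain.  Testing with smooth
    bumps shows that the increments of kappa v' are integrals of w, hence L v = w
    almost everywhere and the edge values exist; testing with cubics of arbitrary
    admissible edge data gives the edge conditions on v. *)

(** * The fundamental theorem of calculus for everywhere derivable functions *)

(** A function of [LL] is twice differentiable at each interior point and nothing more: its second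
    derivative may be discontinuous and unbounded, and neither the function nor its flux need have a
    limit at a node. The fundamental theorem of calculus is therefore obtained in the manner of
    Vitali-Caratheodory: a measure that grows near every point at least as fast as [f] is compared
    with [f] by real induction.

    Conversely, a field [v] in the domain of the adjoint comes without edge values. The increments
    of kappa v' are integrals of the square integrable [w], so kappa v' is integrable and has limits
    at both ends; then kappa >= nu makes v' integrable, and [v] has limits in turn. As kappa v' is
    continuous inside an element, its increment formula holds between any two interior points, not
    just almost all.

    On the algebraic side p + q = gamma and p - q = gamma theta, so A and B are both singular only
    if N is even, gamma = 1 and theta = 0. One invertible matrix is enough because A and B
    commute. *)

Section RealInduction.
Variable R : realType.

(** Real induction on the set [S] of points up to which [F] stays above [F a]. At [s = sup S] the
    left half of the local condition puts [s] itself in [S], and the right half moves past [s]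
    unless [s = b]. No continuity of [F] enters, so [F] may jump, as the distribution function of a
    measure does. *)
Lemma le_of_locally_nondecreasing (F : R -> R) (a b : R) : a <= b ->
  (forall x, a <= x <= b -> \forall t \near x,
     (x <= t <= b -> F x <= F t) /\ (a <= t <= x -> F t <= F x)) ->
  F a <= F b.
Proof.
move=> ab locF.
pose S := [set x | a <= x <= b /\ forall y, a <= y <= x -> F a <= F y].
have Sa : S a.
  split=> [|y /andP[ay ya]]; first by rewrite lexx.
  by have -> : y = a by apply/eqP; rewrite eq_le ya ay.
have ubS : ubound S b by move=> x [/andP[]].
have hS : has_sup S by split; [exists a | exists b].
set s := sup S.
have sS : ubound S s by apply: sup_upper_bound.
have as_ : a <= s by exact: sS.
have sb : s <= b by apply: ge_sup => //; exists a.
have /nbhs_ballP[d /= d0 locs] := locF s (introT andP (conj as_ sb)).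
have Fs y : a <= y <= s -> F a <= F y.
  move=> /andP[ay]; rewrite le_eqVlt => /predU1P[->|ys].
    have [x Sx sx] := sup_adherent d0 hS.
    have xs := sS _ Sx.
    have : ball s d x.
      by rewrite /ball /= ger0_norm ?subr_ge0//; rewrite -/s in sx; lra.
    case: Sx => /andP[ax xb] Fx /locs[_ /(_ _)] Fxs.
    by apply: le_trans (Fxs _); [apply: Fx; rewrite ax lexx | rewrite ax xs].
  have sy0 : 0 < s - y by rewrite subr_gt0.
  have [x Sx] := sup_adherent sy0 hS; rewrite -/s => yx.
  case: Sx => _; apply; rewrite ay/=; lra.
have [sb'|bs] := ltP s b; last by apply: Fs; rewrite ab bs.
pose t := Num.min b (s + d / 2).
have st : s < t by rewrite lt_min sb' ltrDl divr_gt0.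
have : S t.
  split=> [|y /andP[ay yt]].
    by rewrite (le_trans as_ (ltW st))/= ge_min lexx.
  have [ys|sy] := leP y s; first by apply: Fs; rewrite ay ys.
  apply: (@le_trans _ _ (F s)); first by apply: Fs; rewrite as_ lexx.
  have : ball s d y.
    rewrite /ball /= ltr0_norm ?subr_lt0//.
    move: yt; rewrite le_min => /andP[_]; lra.
  move=> /locs[+ _]; apply; rewrite (ltW sy)/=.
  by move: yt; rewrite le_min => /andP[].
by move=> /sS; rewrite leNgt st.
Qed.

End RealInduction.

Section Domination.
Variable R : realType.
Notation mu := (@lebesgue_measure R).

(* The measure [\sum_n e (n + 1) mu (. `&` V n)], where the open set [V n] is
   a tight neighbourhood of [e n <= h < e (n + 1)], plays the role of the lower
   semicontinuous majorant in the Vitali-Caratheodory theorem. *)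
Lemma exists_dominating_measure (h : R -> R) (a b e : R) : a <= b -> 0 < e ->
  (forall y, 0 <= h y) ->
  mu.-integrable `[a, b] (EFin \o h) ->
  exists nu : {measure set (measurableTypeR R) -> \bar R},
    (nu `[a, b]%classic <=
       \int[mu]_(y in `[a, b]) (h y)%:E + (e * (b - a) + e)%:E)%E /\
    forall y, a <= y <= b -> exists r d : R, [/\ h y < r, 0 < d &
      forall s t, y - d < s -> s <= t -> t < y + d ->
        ((r * (t - s))%:E <= nu `]s, t]%classic)%E].
Proof.
move=> ab e0 h0 hint.
have [mh _] := integrableP _ _ _ hint.
move/measurable_EFinP : mh => mh.
pose E n := `[a, b] `&` h @^-1` `[e * n%:R, e * n.+1%:R[.
have mE n : measurable (E n) by apply: mh => //; exact: measurable_itv.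
have muab : mu `[a, b]%classic = (b - a)%:E.
  rewrite lebesgue_measure_itv/= lte_fin; case: ltgtP ab => // -> _.
  by rewrite subrr.
have finE n : (mu (E n) < +oo)%E.
  apply: (@le_lt_trans _ _ (mu `[a, b]%classic)); last by rewrite muab ltry.
  apply: le_measure; rewrite ?inE; [exact: mE|exact: measurable_itv|exact: subIsetl].
(* The tolerance for [V n] carries the factor [1 / (n + 1)] to absorb the weight [e (n + 1)]: the
   weighted excess is [e / 2 ^ (n + 1)], and these sum to [e]. *)
have d0 n : 0 < (n.+1%:R)^-1 * ((2 ^ n.+1)%:R)^-1 :> R.
  by rewrite mulr_gt0 ?invr_gt0 ?ltr0n ?expn_gt0.
have /choice[V HV] n := lebesgue_regularity_outer (mE n) (finE n) (d0 n).
have mV n : measurable (V n) by apply: open_measurable; case: (HV n).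
have c0 n : 0 <= e * n.+1%:R by rewrite mulr_ge0// ltW.
pose nu : {measure set _ -> \bar R} :=
  mseries (fun n => mscale (NngNum (c0 n)) (mrestr mu (mV n))) 0.
have nuE A : nu A = (\sum_(0 <= n <oo) ((e * n.+1%:R)%:E * mu (A `&` V n)))%E by [].
exists nu; split.
  (* Since [e n <= h] on [E n], the weight [e (n + 1)] is at most [h + e] there; summing over [n]
     yields the integral of [h] plus [e (b - a)]. *)
  have cE n : ((e * n.+1%:R)%:E * mu (E n) <=
      \int[mu]_(y in E n) (h y + e)%:E)%E.
    rewrite -integral_cst; last exact: mE.
    apply: ge0_le_integral => //.
    - exact: mE.
    - by move=> y _; rewrite lee_fin c0.
    - apply/measurable_EFinP; apply: measurable_funD => //.
      by apply: measurable_funS mh => //; exact: subIsetl.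
    - move=> y [_] /=; rewrite in_itv/= => /andP[le1 _].
      by rewrite lee_fin -natr1 mulrDr mulr1 lerD2r.
  have mVE n : (mu (`[a, b] `&` V n) <=
      mu (E n) + (n.+1%:R^-1 * ((2 ^ n.+1)%:R)^-1)%:E)%E.
    have [oV sV /ltW le1] := HV n.
    apply: (@le_trans _ _ (mu (V n))).
      apply: le_measure; rewrite ?inE; [|exact: mV|exact: subIsetr].
      by apply: measurableI => //; exact: mV.
    rewrite -[X in mu X](setDUK sV) measureU//; last 3 first.
    - exact: mE.
    - by apply: measurableD => //; [exact: mV|exact: mE].
    - by rewrite setDE setICA setICr setI0.
    by rewrite leeD2l.
  rewrite nuE.
  apply: (@le_trans _ _ (\sum_(0 <= n <oo) ((e * n.+1%:R)%:E * mu (E n)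
      + (e / (2 ^ n.+1)%:R)%:E))%E).
    apply: lee_nneseries => [n _ _|n _]; first by rewrite mule_ge0// lee_fin c0.
    apply: (le_trans (lee_wpmul2l _ (mVE n))); first by rewrite lee_fin c0.
    rewrite muleDr//; last first.
      by apply: ge0_adde_def; rewrite inE ?measure_ge0// lee_fin ltW.
    rewrite leeD2l// -EFinM lee_fin mulrA -(mulrA e) mulfV ?mulr1 ?pnatr_eq0//.
  apply: (le_trans (epsilon_trick _ _ (ltW e0))).
    by move=> n; rewrite mule_ge0// lee_fin c0.
  rewrite EFinD addeA leeD2r//.
  apply: (@le_trans _ _ (\sum_(0 <= n <oo) \int[mu]_(y in E n) (h y + e)%:E)%E).
    apply: lee_nneseries => [n _ _|n _]; first by rewrite mule_ge0// lee_fin c0.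
    exact: cE.
  have Eab : \bigcup_n E n = `[a, b]%classic.
    apply/seteqP; split=> [y [n _ []]//|y yab].
    exists (Num.trunc (h y / e)) => //; split => //=; rewrite in_itv/=.
    have /trunc_itv/andP[] : 0 <= h y / e by rewrite divr_ge0// ltW.
    by rewrite ler_pdivlMr// ltr_pdivrMr// ![_ * e]mulrC => -> ->.
  rewrite -ge0_integral_bigcup//; first last.
  - move=> i j _ _ [y [[_ +] [_ +]]] .
    rewrite /preimage/= !in_itv/=.
    move=> /andP[i1 i2] /andP[j1 j2].
    have := le_lt_trans i1 j2; have := le_lt_trans j1 i2.
    by rewrite !ltr_pM2l// !ltr_nat !ltnS => ji ij; apply/eqP; rewrite eqn_leq ij ji.
  - by move=> y _; rewrite lee_fin addr_ge0// ltW.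
  - by rewrite Eab; apply/measurable_EFinP; apply: measurable_funD.
  rewrite Eab; under eq_integral do rewrite EFinD.
  rewrite ge0_integralD//; last 3 first.
  - by move=> y _; rewrite lee_fin.
  - exact/measurable_EFinP.
  - by move=> y _; rewrite lee_fin ltW.
  by rewrite leeD2l// integral_cst// EFinM -muab.
move=> y yab; pose n := Num.trunc (h y / e).
have /trunc_itv/andP[n1 n2] : 0 <= h y / e by rewrite divr_ge0// ltW.
rewrite -/n ler_pdivlMr// ltr_pdivrMr// ![_ * e]mulrC in n1 n2.
have [oV sV _] := HV n.
have Vy : V n y by apply: sV; split; rewrite /= in_itv//= n1 n2.
have /nbhs_ballP[d /= dpos dV] : nbhs y (V n) by exact: open_nbhs_nbhs.
exists (e * n.+1%:R), d; split => // s t ys st ty.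
apply: (@le_trans _ _ ((e * n.+1%:R)%:E * mu (`]s, t]%classic `&` V n))%E).
  rewrite setIidl; last first.
    move=> z /=; rewrite in_itv/= => /andP[sz zt]; apply: dV.
    by rewrite /ball/= ltr_distlC; apply/andP; split; lra.
  rewrite lebesgue_measure_itv/= lte_fin.
  case: ltgtP st => // -> _.
  by rewrite subrr mulr0 mule0.
rewrite nuE (@nneseriesD1 _ _ n)//; last first.
  by move=> k _; rewrite mule_ge0// lee_fin c0.
rewrite leeDl// nneseries_ge0// => k _ _; by rewrite mule_ge0// lee_fin c0.
Qed.

End Domination.

Section DerivativeIntegral.
Variable R : realType.
Notation mu := (@lebesgue_measure R).

Lemma derivable_near_dist (f : R -> R) x r : derivable f x 1 ->
  `|derive1 f x| < r -> \forall t \near x, `|f t - f x| <= r * `|t - x|.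
Proof.
move=> dfx fr.
have fcvg : h^-1 *: (f (h + x) - f x) @[h --> 0^'] --> derive1 f x.
  by rewrite /derive1; move: dfx; rewrite /derivable; under eq_fun do
     rewrite /= [_%:A]mulr1.
have := cvgr_norm_lt _ fcvg _ fr.
rewrite near_withinE => /(_ _)/nbhs_ballP[d /= d0 dP].
apply/nbhs_ballP; exists d => // t /= xt.
have [->|tx] := eqVneq t x; first by rewrite !subrr normr0 mulr0.
have tx0 : t - x != 0 by rewrite subr_eq0.
have : ball (0 : R) d (t - x).
  by move: xt; rewrite /ball/= sub0r normrN distrC.
move=> /dP /(_ tx0) /=; rewrite subrK normrM normfV.
by rewrite mulrC ltr_pdivrMr ?normr_gt0// => /ltW.
Qed.

(** With [G y = nu [a, y]] for a measure dominating [|f'|], near each [x] the increments of [G] are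
    at least [r |t - x|] and those of [f] at most that, for some [r > |f' x|]. So [G - f] is locally
    nondecreasing about every point, and the increment of [f] is bounded by [nu [a, b]], which is
    within [e] of the integral. *)
Lemma le_increment_integral_derive (f : R -> R) (a b : R) : a <= b ->
  (forall x, a <= x <= b -> derivable f x 1) ->
  mu.-integrable `[a, b] (EFin \o (derive1 f)) ->
  ((f b - f a)%:E <= \int[mu]_(x in `[a, b]) `|derive1 f x|%:E)%E.
Proof.
move=> ab df intf.
have intnf : mu.-integrable `[a, b] (EFin \o (fun x => `|derive1 f x|)).
  exact: integrable_norm.
have ba1 : 0 < b - a + 1 by rewrite ltr_wpDl// subr_ge0.
apply/lee_addgt0Pr => e e0.
(* Chosen so that [e' (b - a) + e' = e]. *)
pose e' := e / (b - a + 1).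
have e'0 : 0 < e' by rewrite divr_gt0.
have [nu [nuab nuP]] :=
  exists_dominating_measure ab e'0 (fun y => normr_ge0 (derive1 f y)) intnf.
have finint : (\int[mu]_(x in `[a, b]) `|derive1 f x|%:E)%E \is a fin_num.
  exact: integrable_fin_num intnf.
have finab : nu `[a, b]%classic \is a fin_num.
  rewrite ge0_fin_numE ?measure_ge0//; apply: (le_lt_trans nuab).
  by rewrite ltey_eq fin_numD finint.
have fin y : y <= b -> nu `[a, y]%classic \is a fin_num.
  move=> yb; rewrite ge0_fin_numE ?measure_ge0//.
  apply: (@le_lt_trans _ _ (nu `[a, b]%classic)); last by rewrite -ge0_fin_numE.
  apply: le_measure; rewrite ?inE; [exact: measurable_itv|exact: measurable_itv|].
  by apply: subset_itvl; rewrite bnd_simp.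
pose G y := fine (nu `[a, y]%classic).
have Gincr r y z : a <= y -> y <= z -> z <= b ->
    ((r * (z - y))%:E <= nu `]y, z]%classic)%E -> r * (z - y) <= G z - G y.
  move=> ay yz zb rle; rewrite lerBrDr -lee_fin /G EFinD !fineK ?fin//; last exact: le_trans zb.
  have -> : `[a, z]%classic = `[a, y] `|` `]y, z].
    by rewrite -itv_bndbnd_setU// bnd_simp.
  rewrite measureU; [|exact: measurable_itv|exact: measurable_itv|].
    by rewrite addeC leeD2l.
  apply/seteqP; split=> // w [] /=; rewrite !in_itv/= => /andP[_ wy] /andP[yw _].
  by move: wy; rewrite leNgt yw.
have /le_of_locally_nondecreasing : forall x, a <= x <= b -> \forall t \near x,
    (x <= t <= b -> G x - f x <= G t - f t) /\
    (a <= t <= x -> G t - f t <= G x - f x).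
  move=> x xab; have /andP[ax xb] := xab.
  have [r [d [fr d0 nur]]] := nuP _ xab.
  have := derivable_near_dist (df _ xab) fr.
  move=> /nbhs_ballP[d1 /= d10 fd].
  apply/nbhs_ballP; exists (Num.min d d1); first by rewrite /= lt_min d0.
  move=> t; rewrite /ball/= lt_min => /andP[td /fd/= {}fd].
  move: td; rewrite ltr_distlC => /andP[td1 td2].
  split=> /andP[t1 t2].
    have : r * (t - x) <= G t - G x.
      by apply: Gincr => //; apply: nur => //; lra.
    move: fd; rewrite (ger0_norm (_ : 0 <= t - x)) ?subr_ge0// ler_norml.
    by move=> /andP[]; lra.
  have : r * (x - t) <= G x - G t.
    by apply: Gincr => //; apply: nur => //; lra.
  move: fd; rewrite (ler0_norm (_ : t - x <= 0)) ?subr_le0// ler_norml.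
  by move=> /andP[]; lra.
move=> /(_ ab) GG.
apply: (@le_trans _ _ (nu `[a, b]%classic)).
  rewrite -[leRHS]fineK// lee_fin -/(G b).
  have : 0 <= G a by rewrite fine_ge0// measure_ge0.
  lra.
apply: (le_trans nuab); rewrite leeD2l// lee_fin.
by rewrite -{2}[e'](mulr1) -mulrDr /e' divfK// gt_eqF.
Qed.

Lemma le_dist_integral_derive (f : R -> R) (a b : R) : a <= b ->
  (forall x, a <= x <= b -> derivable f x 1) ->
  mu.-integrable `[a, b] (EFin \o (derive1 f)) ->
  (`|f b - f a|%:E <= \int[mu]_(x in `[a, b]) `|derive1 f x|%:E)%E.
Proof.
move=> ab df intf; have [_|_] := ler0P (f b - f a); last first.
  exact: le_increment_integral_derive.
have dNf x : a <= x <= b -> derive1 (- f) x = - derive1 f x.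
  by move=> xab; rewrite !derive1E deriveN//; exact: df.
rewrite opprB addrC -[X in - _ + X]opprK.
apply: le_trans (@le_increment_integral_derive (- f) a b ab _ _) _.
- by move=> x xab; apply: derivableN; exact: df.
- apply: eq_integrable (integrableN intf) => //.
  by move=> x; rewrite inE/= in_itv/= => xab; rewrite /= dNf.
- rewrite le_eqVlt; apply/orP; left; apply/eqP; apply: eq_integral => x.
  by rewrite inE/= in_itv/= => xab; rewrite dNf// normrN.
Qed.

Lemma continuous_primitive (g : R -> R) (a b : R) : continuous g ->
  exists G : R -> R, forall x, a <= x <= b ->
    derivable G x 1 /\ derive1 G x = g x.
Proof.
(* Starting at [a - 1] and stopping at [b + 1] makes [a] and [b] interior, so that the primitive is
   derivable on both sides there. *)
move=> cg; exists (fun y => \int[mu]_(t in `[a - 1, y]) g t) => x /andP[ax xb].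
apply: (@continuous_FTC1 _ g (BLeft (a - 1)) x (b + 1)).
- lra.
- apply: continuous_compact_integrable; first exact: segment_compact.
  exact: continuous_subspaceT.
- rewrite lte_fin; lra.
- exact: cg.
Qed.

(* For an everywhere derivable function no continuity of the derivative is
   needed: subtract a primitive of a continuous function close to [derive1 f] in
   L^1 and bound the increment of the difference. *)
Lemma derivable_FTC2 (f : R -> R) (a b : R) : a <= b ->
  (forall x, a <= x <= b -> derivable f x 1) ->
  mu.-integrable `[a, b] (EFin \o (derive1 f)) ->
  \int[mu]_(x in `[a, b]) derive1 f x = f b - f a.
Proof.
move=> ab df intf.
have muab : (mu `[a, b]%classic < +oo)%E.
  by rewrite lebesgue_measure_itv/=; case: ifP => _; rewrite ?ltry// -EFinD ltry.
have [g [cg ig]] := approximation_continuous_integrable (measurable_itv _) muab intf.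
move=> gcvg; apply/eqP; rewrite -subr_eq0 -normr_le0 -lee_fin.
(* The L^1 error is counted twice: once for the increment of [f - G], once for the integral of
   [derive1 f - g n]. *)
suff le2 n : (`|\int[mu]_(x in `[a, b]) derive1 f x - (f b - f a)|%:E <=
    2%:E * \int[mu]_(z in `[a, b]) `|(derive1 f z - g n z)%:E|)%E.
  have -> : 0%:E = (2%:E * 0)%E :> \bar R by rewrite mule0.
  have lim2 : (2%:E * \int[mu]_(z in `[a, b]) `|(derive1 f z - g n z)%:E| @[n --> \oo]
      --> 2%:E * 0)%E.
    exact: cvgeZl.
  rewrite -(cvg_lim _ lim2)//; apply: lime_ge.
    by apply/cvg_ex; eexists; exact: lim2.
  by apply: nearW => n; exact: le2.
have [G dG] := continuous_primitive a b (cg n).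
have dfG x : a <= x <= b -> derive1 (f - G) x = derive1 f x - g n x.
  move=> xab; have [dGx <-] := dG _ xab.
  by rewrite !derive1E (deriveB (df _ xab) dGx).
have ifG : mu.-integrable `[a, b] (EFin \o (derive1 (f - G))).
  apply: eq_integrable (integrableB _ intf (ig n)) => //.
  by move=> x; rewrite inE/= in_itv/= => xab; rewrite dfG.
have intg : \int[mu]_(x in `[a, b]) g n x = G b - G a.
  move: ab; rewrite le_eqVlt => /predU1P[<-|ltab].
    by rewrite set_itv1 Rintegral_set1 subrr.
  have cG x : a <= x <= b -> {for x, continuous G}.
    by move=> /dG[dGx _]; apply: differentiable_continuous; exact/derivable1_diffP.
  rewrite /Rintegral (continuous_FTC2 ltab (F := G))//.
  - by apply: continuous_subspaceT => z; exact: (cg n).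
  - split.
    + by move=> x; rewrite in_itv/= => /andP[ax xb]; have [] := dG x; rewrite ?ltW.
    + by apply: cvg_at_right_filter; apply: cG; rewrite lexx ltW.
    + by apply: cvg_at_left_filter; apply: cG; rewrite lexx ltW.
  - by move=> x; rewrite in_itv/= => /andP[ax xb]; have [] := dG x; rewrite ?ltW.
have := @le_dist_integral_derive (f - G) a b ab _ ifG.
have -> : (\int[mu]_(x in `[a, b]) `|derive1 (f - G) x|%:E =
   \int[mu]_(z in `[a, b]) `|(derive1 f z - g n z)%:E|)%E.
  by apply: eq_integral => x; rewrite inE/= in_itv/= => xab; rewrite dfG.
set I := (\int[mu]_(z in _) _)%E => le1.
have {}le1 : (`|(f b - f a) - (G b - G a)|%:E <= I)%E.
  rewrite [X in `|X|](_ : _ = (f - G) b - (f - G) a); last by rewrite !fctE; ring.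
  apply: le1 => x xab; apply: derivableB; first exact: df.
  by have [] := dG _ xab.
have le2 : (`|\int[mu]_(x in `[a, b]) derive1 f x - (G b - G a)|%:E <= I)%E.
  rewrite -intg -RintegralB//.
  apply: le_trans (_ : _ <= (\int[mu]_(x in `[a, b]) `|derive1 f x - g n x|)%:E)%E _.
    rewrite lee_fin; apply: le_normr_Rintegral => //.
    exact: (integrableB _ intf (ig n)).
  rewrite /Rintegral fineK//.
  apply: integrable_fin_num => //.
  apply: (@integrable_norm _ _ _ mu _ (fun x => derive1 f x - g n x)).
  exact: (integrableB _ intf (ig n)).
rewrite mule_natl mule2n.
apply: le_trans (leeD le2 le1); rewrite lee_fin.
by rewrite [X in _ <= _ + X]distrC; apply: ler_distD.
Qed.

End DerivativeIntegral.

(** * Open intervals: integrability up to the ends and one-sided limits *)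

Section OpenInterval.
Variable R : realType.
Notation mu := (@lebesgue_measure R).

Lemma integrable_restrict_oo (f : R -> R) (a b : R) (A : set R) : measurable A ->
  mu.-integrable `]a, b[ (EFin \o f) ->
  mu.-integrable A (EFin \o (f \_ `]a, b[)).
Proof.
move=> mA fint; rewrite -restrict_EFin.
apply/integrable_restrict => //.
apply: integrableS fint; [exact: measurable_itv| |exact: subIsetr].
by apply: measurableI => //; exact: measurable_itv.
Qed.

Lemma Rintegral_restrict_oo (f : R -> R) (a b x y : R) : a < x -> y < b ->
  \int[mu]_(t in `[x, y]) (f \_ `]a, b[) t = \int[mu]_(t in `[x, y]) f t.
Proof.
move=> ax yb; apply: eq_Rintegral => t; rewrite inE/= in_itv/= => /andP[xt ty].
by rewrite patchE mem_set//= in_itv/= (lt_le_trans ax xt) (le_lt_trans ty yb).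
Qed.

(* The increments of [F] are the integrals of [f], which is only assumed
   integrable on the open interval, so [F] extends to the closed interval. *)
Lemma increment_integralP (F f : R -> R) (a b c : R) : c \in `]a, b[%R ->
  mu.-integrable `]a, b[ (EFin \o f) ->
  (forall x y, a < x -> x <= y -> y < b ->
     F y - F x = \int[mu]_(t in `[x, y]) f t) ->
  let P y := \int[mu]_(t in `[a, y]) (f \_ `]a, b[) t in
  forall y, y \in `]a, b[%R -> F y = F c - P c + P y.
Proof.
move=> cab fint Ff P y yab.
have /andP[ac cb] : a < c < b by move: cab; rewrite in_itv.
have /andP[ay yb] : a < y < b by move: yab; rewrite in_itv.
have PB x z : a < x -> x <= z -> z < b -> P z - P x = F z - F x.
  move=> ax xz zb; rewrite Ff// -(Rintegral_restrict_oo f ax zb) /P.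
  have itf (i : interval R) : mu.-integrable [set` i] (EFin \o (f \_ `]a, b[)).
    exact: integrable_restrict_oo.
  rewrite Rintegral_itvB// ?bnd_simp ?(ltW ax)//.
  by rewrite Rintegral_itv_obnd_cbnd.
by have [yc|/ltW cy] := leP y c; [have := PB y c ay yc cb|have := PB c y ac cy yb]; lra.
Qed.

Lemma increment_integral_cvg (F f : R -> R) (a b : R) : a < b ->
  mu.-integrable `]a, b[ (EFin \o f) ->
  (forall x y, a < x -> x <= y -> y < b ->
     F y - F x = \int[mu]_(t in `[x, y]) f t) ->
  exists la lb : R, [/\ F y @[y --> a^'+] --> la, F y @[y --> b^'-] --> lb &
    \int[mu]_(t in `]a, b[) f t = lb - la].
Proof.
move=> ab fint Ff; set c := (a + b) / 2.
have cab : c \in `]a, b[%R by rewrite in_itv/= /c; lra.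
have FP := increment_integralP cab fint Ff.
set P := fun y => _ in FP.
have itf (i : interval R) : mu.-integrable [set` i] (EFin \o (f \_ `]a, b[)).
  exact: integrable_restrict_oo.
exists (F c - P c), (F c - P c + P b); split.
- have : F c - P c + P y @[y --> a^'+] --> F c - P c + 0.
    apply: cvgD; first exact: cvg_cst.
    apply: cvg_at_right_filter.
    exact: (parameterized_integral_cvg_left ab (itf _)).
  rewrite addr0; apply: cvg_trans; apply: near_eq_cvg; near=> y.
  apply/esym/FP; rewrite in_itv/=; apply/andP; split => //.
- have : F c - P c + P y @[y --> b^'-] --> F c - P c + P b.
    apply: cvgD; first exact: cvg_cst.
    exact: (parameterized_integral_cvg_at_left ab (itf _)).
  apply: cvg_trans; apply: near_eq_cvg; near=> y.
  apply/esym/FP; rewrite in_itv/=; apply/andP; split => //.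
- rewrite addrAC subrr add0r /P.
  rewrite -Rintegral_itv_obnd_cbnd// -Rintegral_itv_bndo_bndc//.
  by apply: eq_Rintegral => t tab; rewrite patchE ifT.
Unshelve. all: by end_near. Qed.

(** Used for [F = kappa v']: its integrability is what later makes [v'] integrable. *)
Lemma increment_integral_integrable (F f : R -> R) (a b : R) : a < b ->
  mu.-integrable `]a, b[ (EFin \o f) ->
  (forall x y, a < x -> x <= y -> y < b ->
     F y - F x = \int[mu]_(t in `[x, y]) f t) ->
  mu.-integrable `]a, b[ (EFin \o F).
Proof.
move=> ab fint Ff; set c := (a + b) / 2.
have cab : c \in `]a, b[%R by rewrite in_itv/= /c; lra.
have FP := increment_integralP cab fint Ff.
set P := fun y => _ in FP.
have iP : mu.-integrable `]a, b[ (EFin \o (fun y => F c - P c + P y)).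
  apply: (@integrableS _ _ _ mu `[a, b]);
    [exact: measurable_itv|exact: measurable_itv|exact: subset_itv_oo_cc|].
  apply: continuous_compact_integrable; first exact: segment_compact.
  move=> y; apply: cvgD; first exact: cvg_cst.
  apply: parameterized_integral_continuous; first exact: ltW.
  by apply: integrable_restrict_oo => //; exact: measurable_itv.
apply: eq_integrable iP => // y; rewrite inE => yab; congr EFin.
by rewrite (FP _ yab).
Qed.

Lemma derivable_FTC2_oo (f : R -> R) (a b : R) : a < b ->
  (forall x, x \in `]a, b[%R -> derivable f x 1) ->
  mu.-integrable `]a, b[ (EFin \o (derive1 f)) ->
  exists la lb : R, [/\ f y @[y --> a^'+] --> la, f y @[y --> b^'-] --> lb &
    \int[mu]_(t in `]a, b[) derive1 f t = lb - la].
Proof.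
move=> ab df intf; apply: increment_integral_cvg => // x y ax xy yb.
rewrite derivable_FTC2//.
  by move=> z /andP[xz zy]; apply: df; rewrite in_itv/= (lt_le_trans ax xz) (le_lt_trans zy yb).
apply: integrableS intf => //.
move=> z; rewrite /= !in_itv/= => /andP[xz zy].
by rewrite (lt_le_trans ax xz) (le_lt_trans zy yb).
Qed.

(** The derivative is the pointwise limit of difference quotients with step [1 / (n + 1)]. They are
    taken for [f] cut off to zero outside the interval, as nothing is known of [f] there; for large
    [n] the cut-off is not seen. *)
Lemma measurable_derive1_oo (f : R -> R) (a b : R) :
  (forall x, x \in `]a, b[%R -> derivable f x 1) ->
  measurable_fun `]a, b[ (derive1 f).
Proof.
move=> df.
have mf : measurable_fun setT (f \_ `]a, b[).
  apply/(measurable_restrictT _ _).1 => //.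
  apply: open_continuous_measurable_fun => // x; rewrite inE => xab.
  by apply: differentiable_continuous; apply/derivable1_diffP; exact: df.
pose h n x := n.+1%:R * ((f \_ `]a, b[) (n.+1%:R^-1 + x) - (f \_ `]a, b[) x).
apply: (@measurable_realfun.measurable_fun_cvg _ _ _ _ h).
  move=> n; apply: measurable_funTS; apply: measurable_funM => //.
  apply: measurable_funB => //.
  apply: measurableT_comp => //.
  exact: measurable_funD.
move=> x xab; have /andP[ax xb] : a < x < b by move: xab; rewrite /= in_itv.
have : k^-1 *: (f (k + x) - f x) @[k --> 0^'] --> derive1 f x.
  have := df _ xab.
  by rewrite /derive1 /derivable; under eq_fun do rewrite /= [_%:A]mulr1.
move/cvgr_dnbhsP => /(_ (fun n => n.+1%:R^-1)).
move=> /(_ (conj (fun n => invr_neq0 (lt0r_neq0 (ltr0Sn R n))) cvg_harmonic)).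
apply: cvg_trans; apply: near_eq_cvg; near=> n.
have nxab : (n.+1%:R^-1 + x)%R \in `]a, b[%R.
  rewrite in_itv/=; apply/andP; split.
    by rewrite (lt_le_trans ax)// lerDr.
  rewrite -ltrBrDr; near: n; apply: (cvgr_lt (0 : R)); first exact: cvg_harmonic.
  by rewrite subr_gt0.
by rewrite /= /h !patchE !mem_set// invrK.
Unshelve. all: by end_near. Qed.

(** Lebesgue's differentiation theorem for the indefinite integral [P], from which [F] differs by a
    constant on the whole open interval. *)
Lemma increment_integral_derive1 (F f : R -> R) (a b : R) : a < b ->
  mu.-integrable `]a, b[ (EFin \o f) ->
  (forall x y, a < x -> x <= y -> y < b ->
     F y - F x = \int[mu]_(t in `[x, y]) f t) ->
  {ae mu, forall y, y \in `]a, b[%R -> derive1 F y = f y}.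
Proof.
move=> ab fint Ff; set c := (a + b) / 2.
have cab : c \in `]a, b[%R by rewrite in_itv/= /c; lra.
have FP := increment_integralP cab fint Ff.
set P := fun y => _ in FP.
have itf (A : set R) : measurable A -> mu.-integrable A (EFin \o (f \_ `]a, b[)).
  by move=> mA; exact: integrable_restrict_oo.
have : locally_integrable setT (f \_ `]a, b[).
  exact: integrable_locally.
move=> /(@FTC1 _ _ (BLeft a) (fun y => itf _ _)).
move=> /(_ (fun y => measurable_itv _)).
apply: filterS; first exact: (ae_filter_ringOfSetsType mu).
move=> y Py yab.
have [dP P'] : derivable P y 1 /\ derive1 P y = (f \_ `]a, b[) y.
  by apply: Py; move: yab; rewrite in_itv/= => /andP[ay _]; rewrite lte_fin.
have FPy : {near y, F =1 cst (F c - P c) + P}.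
  near=> z; apply: FP.
  by near: z; exact: near_in_itvoo.
rewrite derive1E (near_eq_derive _ FPy).
rewrite (deriveD (@derivable_cst _ _ _ _ _ _) dP) derive_cst add0r -derive1E P'.
by rewrite patchE mem_set.
Unshelve. all: by end_near. Qed.

End OpenInterval.

(** * Green's formula *)

Section SquareIntegrable.
Variable R : realType.
Notation mu := (@lebesgue_measure R).

Definition L2on (D : set R) (u : R -> R) : Prop :=
  measurable_fun D u /\ mu.-integrable D (fun y => (u y ^+ 2)%:E).

Lemma L2on_mul (D : set (measurableTypeR R)) (u v : R -> R) : measurable D ->
  L2on D u -> L2on D v -> mu.-integrable D (EFin \o (fun y => v y * u y)).
Proof.
move=> mD [mu_ iu] [mv iv].
apply: le_integrable (integrableD mD iu iv) => //.
  by apply/measurable_EFinP; exact: measurable_funM.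
move=> y _ /=; rewrite lee_fin normrM.
rewrite [leRHS]ger0_norm ?addr_ge0 ?sqr_ge0//.
rewrite -(real_normK (num_real (u y))) -(real_normK (num_real (v y))).
have := sqr_ge0 (`|u y| - `|v y|).
have := normr_ge0 (u y); have := normr_ge0 (v y).
nra.
Qed.

Lemma L2on_continuous (f : R -> R) (a b : R) : continuous f ->
  L2on `]a, b[ f.
Proof.
move=> cf; split.
  by apply: measurable_funTS; exact: continuous_measurable_fun.
apply: (@integrableS _ _ _ mu `[a, b]) => //.
- exact: subset_itv_oo_cc.
- apply: continuous_compact_integrable; first exact: segment_compact.
  by apply: continuous_subspaceT => y; apply: cvgM; exact: cf.
Qed.

Lemma eq_L2on (D : set (measurableTypeR R)) (u v : R -> R) : measurable D ->
  {in D, u =1 v} -> L2on D u -> L2on D v.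
Proof.
move=> mD uv [mu_ iu]; split; first exact: eq_measurable_fun mu_.
by apply: eq_integrable iu => // y yD; rewrite uv.
Qed.

Lemma L2on_integrable (u : R -> R) (a b : R) :
  L2on `]a, b[ u -> mu.-integrable `]a, b[ (EFin \o u).
Proof.
move=> uL2.
have c1 : continuous (cst 1 : R -> R) by move=> x; exact: cvg_cst.
have i1 := L2on_mul (measurable_itv _) uL2 (L2on_continuous a b c1).
by apply: eq_integrable i1 => // y _; rewrite /= mul1r.
Qed.

(** Measurability of [u] is a separate hypothesis because it means Borel measurability, which does
    not pass across an almost everywhere equality. *)
Lemma L2on_ae_eq (u v : R -> R) (a b : R) : measurable_fun `]a, b[ u ->
  {ae mu, forall y, y \in `]a, b[%R -> u y = v y} ->
  L2on `]a, b[ v -> L2on `]a, b[ u.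
Proof.
move=> mu_ uv [mv iv]; split => //.
have mu2 : measurable_fun `]a, b[ (fun y => (u y ^+ 2)%:E).
  by apply/measurable_EFinP; exact: measurable_funX.
apply/integrableP; split => //.
have [mv2] := integrableP _ _ _ iv; apply: le_lt_trans.
rewrite le_eqVlt; apply/orP; left; apply/eqP.
apply: ge0_ae_eq_integral => //.
- exact: measurableT_comp.
- exact: measurableT_comp.
apply: filterS uv; first exact: (ae_filter_ringOfSetsType mu).
by move=> y uvy yab; rewrite uvy.
Qed.

End SquareIntegrable.

Section Green.
Variable R : realType.
Notation mu := (@lebesgue_measure R).

Lemma derive1_mul (u v : R -> R) (y : R) : derivable u y 1 -> derivable v y 1 ->
  derivable (fun z => u z * v z) y 1 /\
  derive1 (fun z => u z * v z) y = u y * derive1 v y + v y * derive1 u y.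
Proof.
move=> du dv; split; first exact: (derivableM du dv).
by rewrite !derive1E; exact: (deriveM du dv).
Qed.

Lemma derive1_sub (u v : R -> R) (y : R) : derivable u y 1 -> derivable v y 1 ->
  derivable (fun z => u z - v z) y 1 /\
  derive1 (fun z => u z - v z) y = derive1 u y - derive1 v y.
Proof.
move=> du dv; split; first exact: (derivableB du dv).
by rewrite !derive1E; exact: (deriveB du dv).
Qed.

Lemma derive1_cross (u v p q : R -> R) (y : R) :
  derivable u y 1 -> derivable v y 1 -> derivable p y 1 -> derivable q y 1 ->
  derivable (fun z => v z * p z - u z * q z) y 1 /\
  derive1 (fun z => v z * p z - u z * q z) y =
    v y * derive1 p y + p y * derive1 v y - (u y * derive1 q y + q y * derive1 u y).
Proof.
move=> du dv dp dq.
have [dvp vp'] := derive1_mul dv dp; have [duq uq'] := derive1_mul du dq.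
have [dc c'] := derive1_sub dvp duq; split; first exact: dc.
by rewrite c' vp' uq'.
Qed.

(** Lagrange's identity: with [p = k u'] and [q = k v'], the derivative of [v p - u q] is
    [v p' - u q'], because [p v'] and [q u'] both equal [k u' v']. Working with this combination
    calls only for products of square integrable functions, and for no integrability of [u'] or
    [v']. *)
Lemma green_oo (k u v : R -> R) (a b uL uR vL vR pL pR qL qR : R) : a < b ->
  (forall y, y \in `]a, b[%R -> derivable k y 1) ->
  (forall y, y \in `]a, b[%R -> derivable u y 1 /\ derivable (derive1 u) y 1) ->
  (forall y, y \in `]a, b[%R -> derivable v y 1 /\ derivable (derive1 v) y 1) ->
  L2on `]a, b[ u -> L2on `]a, b[ v ->
  L2on `]a, b[ (derive1 (fun z => k z * derive1 u z)) ->
  L2on `]a, b[ (derive1 (fun z => k z * derive1 v z)) ->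
  u y @[y --> a^'+] --> uL -> u y @[y --> b^'-] --> uR ->
  v y @[y --> a^'+] --> vL -> v y @[y --> b^'-] --> vR ->
  k y * derive1 u y @[y --> a^'+] --> pL ->
  k y * derive1 u y @[y --> b^'-] --> pR ->
  k y * derive1 v y @[y --> a^'+] --> qL ->
  k y * derive1 v y @[y --> b^'-] --> qR ->
  \int[mu]_(y in `]a, b[) (v y * derive1 (fun z => k z * derive1 u z) y) -
  \int[mu]_(y in `]a, b[) (derive1 (fun z => k z * derive1 v z) y * u y) =
  (vR * pR - uR * qR) - (vL * pL - uL * qL).
Proof.
move=> ab dk du dv u2 v2 Au2 Av2 huL huR hvL hvR hpL hpR hqL hqR.
set p := (fun z => k z * derive1 u z); set q := (fun z => k z * derive1 v z).
have dp y : y \in `]a, b[%R -> derivable p y 1.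
  by move=> yab; apply: derivableM; [exact: dk|have [] := du _ yab].
have dq y : y \in `]a, b[%R -> derivable q y 1.
  by move=> yab; apply: derivableM; [exact: dk|have [] := dv _ yab].
pose g z := v z * p z - u z * q z.
have dg y : y \in `]a, b[%R -> derivable g y 1.
  move=> yab; have [duy _] := du _ yab; have [dvy _] := dv _ yab.
  by have [] := derive1_cross duy dvy (dp _ yab) (dq _ yab).
have g' y : y \in `]a, b[%R ->
    derive1 g y = v y * derive1 p y - derive1 q y * u y.
  move=> yab; have [duy _] := du _ yab; have [dvy _] := dv _ yab.
  have [_ ->] := derive1_cross duy dvy (dp _ yab) (dq _ yab).
  have -> : p y = k y * derive1 u y by [].
  have -> : q y = k y * derive1 v y by [].
  move: (u y) (v y) (k y) (derive1 u y) (derive1 v y) (derive1 p y) (derive1 q y).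
  by move=> *; ring.
have iu := L2on_mul (measurable_itv _) Au2 v2.
have iv := L2on_mul (measurable_itv _) u2 Av2.
have [|la [lb [gla glb]]] := derivable_FTC2_oo ab dg.
  apply: eq_integrable (integrableB _ iu iv) => //.
  by move=> y; rewrite inE => yab; rewrite /= g'.
have -> : lb = vR * pR - uR * qR.
  by apply: (cvg_unique _ glb) => //; apply: cvgB; apply: cvgM.
have -> : la = vL * pL - uL * qL.
  by apply: (cvg_unique _ gla) => //; apply: cvgB; apply: cvgM.
move=> <-; rewrite -RintegralB//; apply: eq_Rintegral => y.
by rewrite inE => yab; rewrite /= g'.
Qed.

End Green.

(** * Smoothness of the diffusivities *)

Section Diffusivity.
Variables (R : realType) (N : nat).

(** The diffusivity is minus [d_ux f] along the line [y |-> (y, U j, 0)], so its difference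
    quotients are those of [- d_ux f] in the direction [e1]. Its derivative is thus an iterated
    directional derivative of [f], continuous by smoothness. *)
Lemma diffusivityP (f : R * R * R -> R) (U : 'I_N -> R) (j : 'I_N) : smooth f ->
  (forall y, derivable (diffusivity f U j) y 1) /\
  continuous (derive1 (diffusivity f U j)).
Proof.
move=> sf; pose e1 : R * R * R := (1, 0, 0); pose g := d_ux f.
have [_ dg] := sf [:: (0, 0, 1)].
have [cg' _] := sf [:: e1; (0, 0, 1)].
pose pt (y : R) : R * R * R := (y, U j, 0).
have quot y : (fun h : R => h^-1 *: ((diffusivity f U j \o shift y) (h *: 1) -
    diffusivity f U j y)) =
    (fun h : R => - (h^-1 *: ((g \o shift (pt y)) (h *: e1) - g (pt y)))).
  apply/funext => h; rewrite /diffusivity -/g /= -scalerN opprB opprK addrC.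
  congr (_ *: (_ - _)); congr (g _).
  by rewrite /shift/= /pt /e1; congr (_, _, _); rewrite /= ?scaler0 ?add0r.
have dk y : derivable (diffusivity f U j) y 1.
  by rewrite /derivable quot; apply: is_cvgN; exact: dg.
have k' y : derive1 (diffusivity f U j) y = - iter_derive [:: e1; (0, 0, 1)] f (pt y).
  rewrite derive1E /derive quot; apply/cvg_lim => //; apply: cvgN.
  exact: dg.
split; first exact: dk.
move=> y.
have -> : derive1 (diffusivity f U j) =
    (fun z => - iter_derive [:: e1; (0, 0, 1)] f (pt z)) by apply/funext.
apply: cvgN.
have : pt z @[z --> y] --> pt y.
  have c2 : (z, U j) @[z --> y] --> (y, U j).
    exact: (cvg_pair (@cvg_id _ _) (@cvg_cst _ _ _ _ _)).
  exact: (cvg_pair c2 (@cvg_cst _ _ _ _ _)).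
move=> cpt; apply: (cvg_comp _ _ cpt); exact: cg'.
Qed.

End Diffusivity.

(** * The operator and Green's formula on the union of the elements *)

Section Elements.
Variables (R : realType) (ell : R) (N : nat) (x : nat -> R) (kappa : 'I_N -> R -> R).
Notation mu := (@lebesgue_measure R).
Hypothesis x_incr : forall j : nat, (j < N)%N -> x j < x j.+1.

Lemma node_le (i j : nat) : (i <= j)%N -> (j <= N)%N -> x i <= x j.
Proof.
elim: j => [|j IHj]; first by rewrite leqn0 => /eqP->.
rewrite leq_eqVlt => /predU1P[->//|ij] jN.
by apply: le_trans (IHj ij (ltnW jN)) (ltW (x_incr jN)).
Qed.

Lemma elt_disjoint (i j : 'I_N) (y : R) : y \in elt x i -> y \in elt x j -> i = j.
Proof.
rewrite /elt !in_itv/= => /andP[i1 i2] /andP[j1 j2]; apply/val_inj => /=.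
case: (ltngtP i j) => // ij.
  by have := node_le ij (ltnW (ltn_ord j)); rewrite leNgt (lt_trans j1 i2).
by have := node_le ij (ltnW (ltn_ord i)); rewrite leNgt (lt_trans i1 j2).
Qed.

Lemma LopE (u : R -> R) (j : 'I_N) (y : R) : y \in elt x j ->
  Lop x kappa u y = derive1 (fun z => kappa j z * derive1 u z) y.
Proof.
move=> yj; rewrite /Lop (big_pred1 j)// => i; apply/idP/eqP => [yi|->//].
exact: elt_disjoint yi yj.
Qed.

Lemma square_integrableP (u : R -> R) : square_integrable N x u <->
  forall j : 'I_N, L2on `]x j, x j.+1[ u.
Proof. by []. Qed.

Lemma square_integrable_Lop (u : R -> R) : square_integrable N x (Lop x kappa u) <->
  forall j : 'I_N, L2on `]x j, x j.+1[ (derive1 (fun z => kappa j z * derive1 u z)).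
Proof.
split=> uL j.
  apply: eq_L2on (uL j); first exact: measurable_itv.
  by move=> y; rewrite inE => yj; rewrite (LopE _ yj).
apply: eq_L2on (uL j); first exact: measurable_itv.
by move=> y; rewrite inE => yj; rewrite (LopE _ yj).
Qed.

Lemma inner_LopE (u v : R -> R) : inner N x v (Lop x kappa u) =
  \sum_(j < N) \int[mu]_(y in `]x j, x j.+1[)
    (v y * derive1 (fun z => kappa j z * derive1 u z) y).
Proof.
apply: eq_bigr => j _; apply: eq_Rintegral => y; rewrite inE => yj.
by rewrite (LopE _ yj).
Qed.

Lemma inner_Lop_lE (u v : R -> R) : inner N x (Lop x kappa v) u =
  \sum_(j < N) \int[mu]_(y in `]x j, x j.+1[)
    (derive1 (fun z => kappa j z * derive1 v z) y * u y).
Proof.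
apply: eq_bigr => j _; apply: eq_Rintegral => y; rewrite inE => yj.
by rewrite (LopE _ yj).
Qed.

Hypothesis dkappa : forall j y, derivable (kappa j) y 1.

Let uL (u : R -> R) := edgeL x (fun _ : 'I_N => u).
Let uR (u : R -> R) := edgeR x (fun _ : 'I_N => u).
Let fL (u : R -> R) := edgeL x (flux kappa u).
Let fR (u : R -> R) := edgeR x (flux kappa u).

Lemma inner_Lop_green (u v : R -> R) :
  twice_differentiable N x u -> twice_differentiable N x v ->
  square_integrable N x u -> square_integrable N x v ->
  square_integrable N x (Lop x kappa u) -> square_integrable N x (Lop x kappa v) ->
  has_edge_values x (fun _ : 'I_N => u) -> has_edge_values x (fun _ : 'I_N => v) ->
  has_edge_values x (flux kappa u) -> has_edge_values x (flux kappa v) ->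
  inner N x v (Lop x kappa u) - inner N x (Lop x kappa v) u =
  \sum_(j < N) (uR u j * fR v j - uL u j * fL v j)
  - \sum_(j < N) (uR v j * fR u j - uL v j * fL u j).
Proof.
move=> du dv u2 v2 /square_integrable_Lop Au2 /square_integrable_Lop Av2 eu ev efu efv.
rewrite inner_LopE inner_Lop_lE -!sumrB; apply: eq_bigr => j _.
have [uLj uRj] := eu j; have [vLj vRj] := ev j.
have [fuLj fuRj] := efu j; have [fvLj fvRj] := efv j.
(* Fluxes are the negatives of the products [k u'] in [green_oo]; this sign exchanges the two
   boundary sums. *)
have pcvg (w : R -> R) (F : set_system R) (l : R) : Filter F ->
    flux kappa w j y @[y --> F] --> l -> kappa j y * derive1 w y @[y --> F] --> - l.
  move=> FF /(cvgN (F := F)); rewrite /flux; apply: cvg_trans.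
  by apply: near_eq_cvg; apply: nearW => y /=; rewrite opprK.
have := green_oo (x_incr (ltn_ord j)) (fun y _ => @dkappa j y) (du j) (dv j)
  (u2 j) (v2 j) (Au2 j) (Av2 j) uLj uRj vLj vRj
  (pcvg _ _ _ _ fuLj) (pcvg _ _ _ _ fuRj) (pcvg _ _ _ _ fvLj) (pcvg _ _ _ _ fvRj).
move=> ->; rewrite /uL /uR /fL /fR /edgeL /edgeR.
move: (lim _) (lim _) (lim _) (lim _) (lim _) (lim _) (lim _) (lim _).
by move=> *; ring.
Qed.

End Elements.

(** * Test functions *)

Section PeriodicExtension.
Variables (R : realType) (ell : R) (N : nat) (x : nat -> R) (kappa : 'I_N -> R -> R).
Notation mu := (@lebesgue_measure R).
Hypothesis ell_gt0 : 0 < ell.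
Hypothesis x_incr : forall j : nat, (j < N)%N -> x j < x j.+1.
Hypothesis x_period : x N = x 0%N + ell.
Hypothesis dkappa : forall j y, derivable (kappa j) y 1.
Hypothesis ckappa' : forall j, continuous (derive1 (kappa j)).

Definition twice_continuously_derivable (g : R -> R) : Prop :=
  [/\ forall y, derivable g y 1, forall y, derivable (derive1 g) y 1 &
      continuous (derive1 (derive1 g))].

(** The floor translates [y] by periods into [[x 0, x N[]. At a node the sum is empty and the value
    is 0, which is immaterial. *)
Definition periodic_extension (G : 'I_N -> R -> R) (y : R) : R :=
  let z := y - ell * (Num.floor ((y - x 0%N) / ell))%:~R in
  \sum_(j < N | z \in elt x j) G j z.

Lemma periodic_extension_periodic G : periodic (periodic_extension G) ell.
Proof.
move=> y; rewrite /periodic_extension.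
have -> : (y + ell - x 0%N) / ell = (y - x 0%N) / ell + 1%:~R.
  by rewrite addrAC mulrDl divff// gt_eqF.
rewrite floorDrz ?intr_int//= intrKfloor intrD mulrDr mulr1.
by rewrite opprD addrACA subrr addr0.
Qed.

Lemma periodic_extensionE G (j : 'I_N) (y : R) : y \in elt x j ->
  periodic_extension G y = G j y.
Proof.
move=> yj; have := yj; rewrite /elt in_itv/= => /andP[jy yj1].
have x0y : x 0%N < y by apply: le_lt_trans jy; apply: (node_le x_incr) => //; exact: ltnW.
have yxN : y < x N by apply: lt_le_trans yj1 _; apply: (node_le x_incr).
rewrite /periodic_extension (_ : Num.floor _ = 0).
  rewrite mulr0 subr0 (big_pred1 j)// => i; apply/idP/eqP => [yi|->//].
  exact: (elt_disjoint x_incr yi yj).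
apply/floor_def; rewrite add0r divr_ge0 ?subr_ge0 ?(ltW x0y) ?(ltW ell_gt0)//=.
by rewrite ltr_pdivrMr// mul1r ltrBlDl -x_period.
Qed.

Lemma near_elt (j : 'I_N) (y : R) : y \in elt x j -> \forall z \near y, z \in elt x j.
Proof. exact: near_in_itvoo. Qed.

Lemma periodic_extension_near G (j : 'I_N) (y : R) : y \in elt x j ->
  \forall z \near y, periodic_extension G z = G j z.
Proof.
by move=> /near_elt; apply: filterS => z; exact: periodic_extensionE.
Qed.

Lemma periodic_extension_derive1 G (j : 'I_N) (y : R) : y \in elt x j ->
  derive1 (periodic_extension G) y = derive1 (G j) y.
Proof.
by move=> yj; rewrite !derive1E; apply: near_eq_derive; exact: periodic_extension_near.
Qed.

Lemma periodic_extension_derive1_near G (j : 'I_N) (y : R) : y \in elt x j ->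
  \forall z \near y, derive1 (periodic_extension G) z = derive1 (G j) z.
Proof.
by move=> /near_elt; apply: filterS => z; exact: periodic_extension_derive1.
Qed.

Lemma derivable_continuous (g : R -> R) : (forall y, derivable g y 1) -> continuous g.
Proof.
by move=> dg y; apply: differentiable_continuous; apply/derivable1_diffP; exact: dg.
Qed.

Variable G : 'I_N -> R -> R.
Hypothesis G2 : forall j, twice_continuously_derivable (G j).
Let u := periodic_extension G.

Lemma twice_differentiable_periodic_extension : twice_differentiable N x u.
Proof.
move=> j y yj; have [dG dG' _] := G2 j; split.
- apply: near_eq_derivable (dG y).
  by apply: filterS (periodic_extension_near G yj) => z; exact: esym.
- apply: near_eq_derivable (dG' y).
  by apply: filterS (periodic_extension_derive1_near G yj) => z; exact: esym.
Qed.

Lemma square_integrable_periodic_extension : square_integrable N x u.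
Proof.
apply/square_integrableP => j; have [dG _ _] := G2 j.
apply: eq_L2on (L2on_continuous _ _ (derivable_continuous dG)).
  exact: measurable_itv.
by move=> y; rewrite inE => yj; rewrite /u (periodic_extensionE _ yj).
Qed.

Lemma Lop_periodic_extension (j : 'I_N) (y : R) : y \in elt x j ->
  derive1 (fun z => kappa j z * derive1 u z) y =
  derive1 (fun z => kappa j z * derive1 (G j) z) y.
Proof.
move=> yj; rewrite !derive1E; apply: near_eq_derive.
by apply: filterS (periodic_extension_derive1_near G yj) => z uz; rewrite /u uz.
Qed.

Lemma continuous_derive1_kappaM (j : 'I_N) :
  continuous (derive1 (fun z => kappa j z * derive1 (G j) z)).
Proof.
have [dG dG' cG''] := G2 j.
have -> : derive1 (fun z => kappa j z * derive1 (G j) z) =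
    (fun y => kappa j y * derive1 (derive1 (G j)) y + derive1 (G j) y * derive1 (kappa j) y).
  by apply/funext => y; have [_ ->] := derive1_mul (@dkappa j y) (dG' y).
move=> y; apply: cvgD; apply: cvgM.
- exact: (derivable_continuous (@dkappa j)).
- exact: cG''.
- exact: (derivable_continuous dG').
- exact: ckappa'.
Qed.

Lemma square_integrable_Lop_periodic_extension :
  square_integrable N x (Lop x kappa u).
Proof.
apply/(square_integrable_Lop _ x_incr) => j.
apply: eq_L2on (L2on_continuous _ _ (@continuous_derive1_kappaM j)).
  exact: measurable_itv.
by move=> y; rewrite inE => yj; rewrite Lop_periodic_extension.
Qed.

Lemma cvg_edgeL (j : 'I_N) (g h : R -> R) : {for x j, continuous h} ->
  (forall y, y \in elt x j -> g y = h y) -> g y @[y --> (x j)^'+] --> h (x j).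
Proof.
move=> ch gh; apply: cvg_trans (cvg_at_right_filter ch).
apply: near_eq_cvg; near=> y; apply/esym/gh; rewrite in_itv/=; apply/andP; split => //.
by near: y; apply: nbhs_right_lt; exact: x_incr.
Unshelve. all: by end_near. Qed.

Lemma cvg_edgeR (j : 'I_N) (g h : R -> R) : {for x j.+1, continuous h} ->
  (forall y, y \in elt x j -> g y = h y) -> g y @[y --> (x j.+1)^'-] --> h (x j.+1).
Proof.
move=> ch gh; apply: cvg_trans (cvg_at_left_filter ch).
apply: near_eq_cvg; near=> y; apply/esym/gh; rewrite in_itv/=; apply/andP; split => //.
by near: y; apply: nbhs_left_gt; exact: x_incr.
Unshelve. all: by end_near. Qed.

Lemma periodic_extension_cvg (j : 'I_N) :
  u y @[y --> (x j)^'+] --> G j (x j) /\ u y @[y --> (x j.+1)^'-] --> G j (x j.+1).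
Proof.
have [dG _ _] := G2 j.
have uG y : y \in elt x j -> u y = G j y by exact: periodic_extensionE.
have cG := derivable_continuous dG.
by split; [exact: cvg_edgeL (cG _) uG|exact: cvg_edgeR (cG _) uG].
Qed.

Lemma flux_periodic_extension_cvg (j : 'I_N) :
  flux kappa u j y @[y --> (x j)^'+] --> flux kappa (G j) j (x j) /\
  flux kappa u j y @[y --> (x j.+1)^'-] --> flux kappa (G j) j (x j.+1).
Proof.
have [_ dG' _] := G2 j.
have cf : continuous (flux kappa (G j) j).
  move=> y; apply: cvgN; apply: cvgM.
    exact: (derivable_continuous (@dkappa j)).
  exact: (derivable_continuous dG').
have uf y : y \in elt x j -> flux kappa u j y = flux kappa (G j) j y.
  by move=> yj; rewrite /flux /u (periodic_extension_derive1 _ yj).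
by split; [exact: cvg_edgeL (cf _) uf|exact: cvg_edgeR (cf _) uf].
Qed.

Lemma periodic_extension_edges :
  [/\ has_edge_values x (fun _ : 'I_N => u), has_edge_values x (flux kappa u),
      edgeL x (fun _ : 'I_N => u) = (fun j => G j (x j)),
      edgeR x (fun _ : 'I_N => u) = (fun j => G j (x j.+1)) &
      edgeL x (flux kappa u) = (fun j => flux kappa (G j) j (x j)) /\
      edgeR x (flux kappa u) = (fun j => flux kappa (G j) j (x j.+1))].
Proof.
split.
- by move=> j; have [cL cR] := periodic_extension_cvg j; split; apply/cvg_ex;
    [exists (G j (x j))|exists (G j (x j.+1))].
- by move=> j; have [cL cR] := flux_periodic_extension_cvg j; split; apply/cvg_ex;
    [exists (flux kappa (G j) j (x j))|exists (flux kappa (G j) j (x j.+1))].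
- by apply/funext => j; have [cL _] := periodic_extension_cvg j; apply/cvg_lim.
- by apply/funext => j; have [_ cR] := periodic_extension_cvg j; apply/cvg_lim.
- by split; apply/funext => j; have [cL cR] := flux_periodic_extension_cvg j;
    apply/cvg_lim.
Qed.

Lemma domL_periodic_extension (gamma theta : R) :
  edge_conditions x kappa gamma theta u -> domL ell x kappa gamma theta u.
Proof.
have [eu efu _ _ _] := periodic_extension_edges => ec.
split => //; last exact: square_integrable_Lop_periodic_extension.
split; [exact: periodic_extension_periodic|exact: square_integrable_periodic_extension|].
exact: twice_differentiable_periodic_extension.
Qed.

End PeriodicExtension.

(** * Spline bumps and cubic interpolants *)

Section TestFunctions.
Variable R : realType.
Notation mu := (@lebesgue_measure R).

Lemma is_derive_derive1 (g g' : R -> R) : (forall y : R, is_derive y (1 : R) g (g' y)) ->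
  (forall y, derivable g y 1) /\ derive1 g = g'.
Proof.
by move=> dg; split=> [y|]; [|apply/funext => y; rewrite derive1E]; have [] := dg y.
Qed.

Lemma derive_mulr_norm (y : R) : is_derive y (1 : R) (fun t : R => t * `|t|) (2 * `|y|).
Proof.
have [y0|y0|->] := ltgtP y 0.
- have -> : 2 * `|y| = (- 2 * y) by rewrite ltr0_norm// mulrN mulNr.
  apply: (@near_eq_is_derive _ _ _ (fun t : R => - (t * t))).
    by near=> t; rewrite ltr0_norm ?mulrN//; near: t; exact: (cvgr_lt y cvg_id _ y0).
  apply: is_derive_eq; rewrite /GRing.scale/=; ring.
- have -> : 2 * `|y| = (2 * y) by rewrite gtr0_norm.
  apply: (@near_eq_is_derive _ _ _ (fun t : R => t * t)).
    by near=> t; rewrite gtr0_norm//; near: t; exact: (cvgr_gt y cvg_id _ y0).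
  apply: is_derive_eq; rewrite /GRing.scale/=; ring.
- rewrite normr0 mulr0.
  have c0 : h^-1 *: (((fun t : R => t * `|t|) \o shift 0) (h *: 1) - (0 : R) * `|0 : R|)
      @[h --> (0 : R)^'] --> (0 : R).
    have n0 : `|h| @[h --> (0 : R)^'] --> (0 : R).
      rewrite -[X in _ --> X](@normr0 _ R).
      by apply: cvg_norm; apply: (cvg_within_filter (G := nbhs (0 : R))); exact: cvg_id.
    apply: cvg_trans n0; apply: near_eq_cvg; near=> h.
    have h0 : h != 0 by near: h; exact: nbhs_dnbhs_neq.
    by rewrite /= [h *: 1]mulr1 addr0 mul0r subr0 scalerA mulVf// scale1r.
  by apply: DeriveDef; [apply/cvg_ex; exists 0; exact: c0|exact: cvg_lim c0].
Unshelve. all: by end_near. Qed.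

(* [max(t, 0) ^ k] for k = 1, 2, 3, built on [t * `|t|], whose derivability at 0 is
   the only one that needs an argument. *)
Definition trunc_pow1 (t : R) : R := (t + `|t|) / 2.
Definition trunc_pow2 (t : R) : R := (t * t + t * `|t|) / 2.
Definition trunc_pow3 (t : R) : R := (t * (t * t) + t * (t * `|t|)) / 2.

Lemma derive_trunc_pow2 (y : R) : is_derive y (1 : R) trunc_pow2 (2 * trunc_pow1 y).
Proof.
have dq := derive_mulr_norm y.
have -> : trunc_pow2 = (fun t : R => 2^-1 * (t * t + t * `|t|)).
  by apply/funext => t; rewrite /trunc_pow2 mulrC.
have dt : is_derive y (1 : R) (fun t : R => t * t) (2 * y).
  by apply: is_derive_eq; rewrite /GRing.scale/=; ring.
have := is_deriveZ 2^-1 (is_deriveD dt dq).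
move=> /is_derive_eq; apply; by rewrite /trunc_pow1 /GRing.scale/=; field.
Qed.

Lemma derive_trunc_pow3 (y : R) : is_derive y (1 : R) trunc_pow3 (3 * trunc_pow2 y).
Proof.
have dq := derive_mulr_norm y.
have -> : trunc_pow3 = (fun t : R => 2^-1 * (t * (t * t) + t * (t * `|t|))).
  by apply/funext => t; rewrite /trunc_pow3 mulrC.
have dt : is_derive y (1 : R) (fun t : R => t * (t * t)) (3 * (y * y)).
  by apply: is_derive_eq; rewrite /GRing.scale/=; ring.
have := is_deriveZ 2^-1 (is_deriveD dt (is_deriveM (is_derive_id y (1 : R)) dq)).
move=> /is_derive_eq; apply.
by rewrite /trunc_pow2 /GRing.scale/=; field.
Qed.

Lemma is_derive_affine (g : R -> R) (k c y dg : R) :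
  is_derive (k * (y - c)) (1 : R) g dg ->
  is_derive y (1 : R) (fun z => g (k * (z - c))) (k * dg).
Proof.
move=> dgy; have da : is_derive y (1 : R) (fun z : R => k * (z - c)) k.
  have := is_deriveZ k (is_deriveB (is_derive_id y (1 : R)) (is_derive_cst c y (1 : R))).
  by move=> /is_derive_eq; apply; rewrite /GRing.scale/=; ring.
have := @is_derive1_comp _ g (fun z => k * (z - c)) y dg k dgy da.
by rewrite mulrC.
Qed.

(** The third backward difference kills polynomials of degree at most 2 and sends [t ^ 3] to 6.
    Hence [smoothstep], normalised by [6^-1], is 1 beyond the last knot, and its first two
    derivatives vanish there. *)
Definition third_difference (g : R -> R) (t : R) : R :=
  g t - 3 * g (t - 1) + 3 * g (t - 2) - g (t - 3).

Lemma derive_third_difference (g g' : R -> R) (k y : R) :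
  (forall z : R, is_derive z (1 : R) g (g' z)) ->
  is_derive y (1 : R) (fun t => k * third_difference g t) (k * third_difference g' y).
Proof.
move=> dg.
have sh c : is_derive y (1 : R) (fun t => g (t - c)) (g' (y - c)).
  have := @is_derive_affine g 1 c y (g' (y - c)); rewrite mul1r mul1r => /(_ (dg _)).
  by under eq_fun do rewrite mul1r.
have := is_deriveZ k (is_deriveB (is_deriveD (is_deriveB (dg y) (is_deriveZ 3 (sh 1)))
  (is_deriveZ 3 (sh 2))) (sh 3)).
by move=> /is_derive_eq; apply.
Qed.

(* The primitive of the quadratic B-spline with knots 0, 1, 2 and 3. *)
Definition smoothstep (t : R) : R := 6^-1 * third_difference trunc_pow3 t.
Definition smoothstep1 (t : R) : R := 2^-1 * third_difference trunc_pow2 t.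

Lemma derive_smoothstep (y : R) : is_derive y (1 : R) smoothstep (smoothstep1 y).
Proof.
have := @derive_third_difference _ (fun z => 3 * trunc_pow2 z) 6^-1 y derive_trunc_pow3.
move=> /is_derive_eq; apply.
by rewrite /smoothstep1 /third_difference; field.
Qed.

Lemma derive_smoothstep1 (y : R) :
  is_derive y (1 : R) smoothstep1 (third_difference trunc_pow1 y).
Proof.
have := @derive_third_difference _ (fun z => 2 * trunc_pow1 z) 2^-1 y derive_trunc_pow2.
move=> /is_derive_eq; apply.
by rewrite /third_difference; field.
Qed.

Let tp2_ge (t : R) : 0 <= t -> trunc_pow2 t = t ^+ 2.
Proof. by move=> t0; rewrite /trunc_pow2 ger0_norm//; field. Qed.
Let tp2_le (t : R) : t <= 0 -> trunc_pow2 t = 0.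
Proof. by move=> t0; rewrite /trunc_pow2 ler0_norm//; field. Qed.
Let tp3_ge (t : R) : 0 <= t -> trunc_pow3 t = t ^+ 3.
Proof. by move=> t0; rewrite /trunc_pow3 ger0_norm//; field. Qed.
Let tp3_le (t : R) : t <= 0 -> trunc_pow3 t = 0.
Proof. by move=> t0; rewrite /trunc_pow3 ler0_norm//; field. Qed.
Let tp1_ge (t : R) : 0 <= t -> trunc_pow1 t = t.
Proof. by move=> t0; rewrite /trunc_pow1 ger0_norm//; field. Qed.
Let tp1_le (t : R) : t <= 0 -> trunc_pow1 t = 0.
Proof. by move=> t0; rewrite /trunc_pow1 ler0_norm//; field. Qed.

Lemma smoothstep_le0 (t : R) : t <= 0 ->
  [/\ smoothstep t = 0, smoothstep1 t = 0 & third_difference trunc_pow1 t = 0].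
Proof.
move=> t0; split;
  rewrite /smoothstep /smoothstep1 /third_difference
    ?(tp1_le t0) ?(tp2_le t0) ?(tp3_le t0);
  rewrite ?(tp1_le, tp2_le, tp3_le); try lra.
Qed.

Lemma smoothstep_ge3 (t : R) : 3 <= t ->
  [/\ smoothstep t = 1, smoothstep1 t = 0 & third_difference trunc_pow1 t = 0].
Proof.
move=> t3; split;
  rewrite /smoothstep /smoothstep1 /third_difference ?(tp1_ge, tp2_ge, tp3_ge);
  try lra; by field.
Qed.

Lemma smoothstep1_ge0 (t : R) : 0 <= smoothstep1 t.
Proof.
have [t0|t0] := leP t 0; first by have [_ -> _] := smoothstep_le0 t0.
have [t3|t3] := leP 3 t; first by have [_ -> _] := smoothstep_ge3 t3.
rewrite /smoothstep1 /third_difference (tp2_ge (ltW t0)) (@tp2_le (t - 3)); last lra.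
(* The spline has the pieces [t ^ 2 / 2] on [0, 1], [(- 2 t ^ 2 + 6 t - 3) / 2] on [1, 2] and
   [(3 - t) ^ 2 / 2] on [2, 3]. *)
have [t1|t1] := leP t 1.
  rewrite (@tp2_le (t - 1)); last lra.
  by rewrite (@tp2_le (t - 2)); [nra|lra].
rewrite (@tp2_ge (t - 1)); last lra.
have [t2|t2] := leP t 2; first by rewrite (@tp2_le (t - 2)); [nra|lra].
by rewrite (@tp2_ge (t - 2)); [nra|lra].
Qed.

Lemma smoothstep_itv (t : R) : 0 <= smoothstep t <= 1.
Proof.
have [dS S'] := is_derive_derive1 derive_smoothstep.
have mono : {homo smoothstep : s t / s <= t}.
  move=> s u su.
  apply: (@ger0_derive1_ndecr _ smoothstep s u) (lexx s) su (lexx u).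
  - by move=> z _; exact: dS.
  - by move=> z _; rewrite S'; exact: smoothstep1_ge0.
  - by apply: continuous_subspaceT; exact: derivable_continuous.
have [t0|t0] := leP t 0; first by have [-> _ _] := smoothstep_le0 t0; rewrite lexx ler01.
have [t3|t3] := leP 3 t; first by have [-> _ _] := smoothstep_ge3 t3; rewrite lexx ler01.
have [s0 _ _] := smoothstep_le0 (lexx (0 : R)).
have [s3 _ _] := smoothstep_ge3 (lexx (3 : R)).
by rewrite -{1}s0 -s3 !mono ?ltW.
Qed.

Lemma is_derive2_twice_continuously_derivable (g g1 g2 : R -> R) :
  (forall y : R, is_derive y (1 : R) g (g1 y)) ->
  (forall y : R, is_derive y (1 : R) g1 (g2 y)) -> continuous g2 ->
  [/\ twice_continuously_derivable g, derive1 g = g1 & derive1 (derive1 g) = g2].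
Proof.
move=> /is_derive_derive1[dg gE] /is_derive_derive1[dg1 g1E] cg2.
by rewrite /twice_continuously_derivable !gE !g1E; split.
Qed.

Lemma exists_hermite_interpolant (a b s t s' t' : R) : a < b ->
  exists g : R -> R, twice_continuously_derivable g /\
    [/\ g a = s, g b = t, derive1 g a = s' & derive1 g b = t'].
Proof.
move=> ab; pose l := b - a; have l0 : l != 0 by rewrite gt_eqF// subr_gt0.
(* Value and slope at [a] are built into [g]; [c] and [d] solve the conditions at [b], namely
   [c l ^ 2 + d l ^ 3 = t - s - l s'] and [2 c l + 3 d l ^ 2 = t' - s']. *)
pose c := (3 * (t - s - l * s') - l * (t' - s')) / l ^+ 2.
pose d := (l * (t' - s') - 2 * (t - s - l * s')) / l ^+ 3.
pose g (y : R) := s + s' * (y - a) +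
    (c * ((y - a) * (y - a)) + d * ((y - a) * ((y - a) * (y - a)))).
pose g1 (y : R) := s' + (2 * c * (y - a) + 3 * d * ((y - a) * (y - a))).
pose g2 (y : R) := 2 * c + 6 * d * (y - a).
have dg y : is_derive y (1 : R) g (g1 y).
  by apply: is_derive_eq; rewrite /g1 /GRing.scale/=; ring.
have dg1 y : is_derive y (1 : R) g1 (g2 y).
  by apply: is_derive_eq; rewrite /g2 /GRing.scale/=; ring.
have cg2 : continuous g2.
  apply: derivable_continuous => y.
  have [//] : is_derive y (1 : R) g2 (6 * d).
  by apply: is_derive_eq; rewrite /GRing.scale/=; ring.
have [g2P gE _] := is_derive2_twice_continuously_derivable dg dg1 cg2.
exists g; split; first exact: g2P.
rewrite gE /g /g1 -/l !subrr; split; rewrite /c /d; try ring; by field.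
Qed.

(** It is supported in [[a, b + 3 h]]. Both ramps, of width [3 h], lie to the right of their knots
    [a] and [b], whence the half-open interval []a, b]] in the limit. *)
Definition bump (a b h y : R) : R :=
  smoothstep (h^-1 * (y - a)) - smoothstep (h^-1 * (y - b)).

Lemma bumpP (a b h : R) :
  [/\ twice_continuously_derivable (bump a b h),
     derive1 (bump a b h) = (fun y => h^-1 * smoothstep1 (h^-1 * (y - a)) -
                                  h^-1 * smoothstep1 (h^-1 * (y - b))) &
     derive1 (derive1 (bump a b h)) = (fun y =>
        h^-1 * (h^-1 * third_difference trunc_pow1 (h^-1 * (y - a))) -
        h^-1 * (h^-1 * third_difference trunc_pow1 (h^-1 * (y - b))))].
Proof.
apply: is_derive2_twice_continuously_derivable.
- move=> y; exact: is_deriveB (is_derive_affine (derive_smoothstep _))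
    (is_derive_affine (derive_smoothstep _)).
- move=> y; exact: is_deriveB
    (is_deriveZ h^-1 (is_derive_affine (derive_smoothstep1 _)))
    (is_deriveZ h^-1 (is_derive_affine (derive_smoothstep1 _))).
- have caff (k c : R) (g : R -> R) : continuous g -> continuous (fun y => g (k * (y - c))).
    move=> cg y; apply: (cvg_comp (fun y => k * (y - c)) g); last exact: cg.
    by apply: cvgM; [exact: cvg_cst|apply: cvgB; [exact: cvg_id|exact: cvg_cst]].
  have ctp1 : continuous trunc_pow1.
    move=> y; apply: cvgM; last exact: cvg_cst.
    by apply: cvgD; [exact: cvg_id|apply: cvg_norm; exact: cvg_id].
  have ctd : continuous (third_difference trunc_pow1).
    have csh (c : R) : continuous (fun y => trunc_pow1 (y - c)).
      move=> y; apply: (cvg_comp (fun y => y - c) trunc_pow1); last exact: ctp1.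
      by apply: cvgB; [exact: cvg_id|exact: cvg_cst].
    move=> y; apply: cvgB; last exact: csh.
    apply: cvgD; last by apply: cvgM; [exact: cvg_cst|exact: csh].
    apply: cvgB; first exact: ctp1.
    by apply: cvgM; [exact: cvg_cst|exact: csh].
  move=> y; apply: cvgB; apply: cvgM; [exact: cvg_cst| |exact: cvg_cst|];
    (apply: cvgM; [exact: cvg_cst|exact: caff]).
Qed.

Lemma bump_eq0 (a b h y : R) : 0 < h -> a < b -> y <= a \/ b + 3 * h <= y ->
  [/\ bump a b h y = 0, derive1 (bump a b h) y = 0 &
      derive1 (derive1 (bump a b h)) y = 0].
Proof.
move=> h0 ab yab; have [_ -> ->] := bumpP a b h; rewrite /bump.
case: yab => yab.
  have le0 c : a <= c -> h^-1 * (y - c) <= 0.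
    by move=> ac; rewrite pmulr_rle0 ?invr_gt0//; lra.
  have [-> -> ->] := smoothstep_le0 (le0 _ (lexx a)).
  have [-> -> ->] := smoothstep_le0 (le0 _ (ltW ab)).
  by rewrite !mulr0 !subrr.
have ge3 c : c <= b -> 3 <= h^-1 * (y - c).
  by move=> cb; rewrite mulrC ler_pdivlMr//; lra.
have [-> -> ->] := smoothstep_ge3 (ge3 _ (lexx b)).
have [-> -> ->] := smoothstep_ge3 (ge3 _ (ltW ab)).
by rewrite !mulr0 !subrr.
Qed.

Lemma bump_norm_le1 (a b h y : R) : `|bump a b h y| <= 1.
Proof.
have /andP[] := smoothstep_itv (h^-1 * (y - a)).
have /andP[] := smoothstep_itv (h^-1 * (y - b)).
by rewrite /bump ler_norml; move=> *; apply/andP; split; lra.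
Qed.

End TestFunctions.

(** * Regularity of the functions in the domain of the adjoint *)

Section WeakDerivative.
Variable R : realType.
Notation mu := (@lebesgue_measure R).

Lemma integrable_continuous_itv (f : R -> R) (a b : R) :
  (forall y, a <= y <= b -> {for y, continuous f}) ->
  mu.-integrable `[a, b] (EFin \o f).
Proof.
move=> cf; apply: continuous_compact_integrable; first exact: segment_compact.
apply: continuous_in_subspaceT => y; rewrite inE/= in_itv/=; exact: cf.
Qed.

Lemma Rintegral_supported (f : R -> R) (A D : set R) : A `<=` D ->
  (forall y, D y -> ~ A y -> f y = 0) ->
  \int[mu]_(y in D) f y = \int[mu]_(y in A) f y.
Proof.
move=> AD f0; rewrite Rintegral_mkcond [RHS]Rintegral_mkcond.
apply: eq_Rintegral => y _; rewrite !patchE.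
case: ifPn => [|yD]; rewrite ?inE.
  by move=> Dy; case: ifPn => //; rewrite notin_setE => /(f0 _ Dy).
by case: ifPn => //; rewrite inE => /AD; move: yD; rewrite notin_setE.
Qed.

(** The kernel [k] is nonnegative, has integral 1 and vanishes off [[c, c + 3 h]]: the integral is
    an average of values of [phi] that are all within [e] of [phi c]. *)
Lemma smoothstep_delta (phi : R -> R) (a b c h e : R) :
  0 < h -> a <= c -> c + 3 * h <= b ->
  (forall y, a <= y <= b -> {for y, continuous phi}) ->
  (forall y, c <= y <= c + 3 * h -> `|phi y - phi c| <= e) ->
  `|\int[mu]_(y in `[a, b]) (phi y * (h^-1 * smoothstep1 (h^-1 * (y - c)))) - phi c| <= e.
Proof.
move=> h0 ac cb cphi phie.
have ab : a <= b by lra.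
pose s y := smoothstep (h^-1 * (y - c)).
pose k y := h^-1 * smoothstep1 (h^-1 * (y - c)).
have [ds sE] : (forall y, derivable s y 1) /\ derive1 s = k.
  by apply: is_derive_derive1 => y; exact: is_derive_affine (derive_smoothstep _).
have [dk _] : (forall y, derivable k y 1) /\ derive1 k =
    (fun y => h^-1 * (h^-1 * third_difference (@trunc_pow1 R) (h^-1 * (y - c)))).
  apply: is_derive_derive1 => y.
  rewrite /k; exact: (is_deriveZ h^-1 (is_derive_affine (derive_smoothstep1 _))).
have ck := derivable_continuous dk.
have k0 y : 0 <= k y by rewrite mulr_ge0 ?invr_ge0 ?(ltW h0)//; exact: smoothstep1_ge0.
have ik : mu.-integrable `[a, b] (EFin \o k).
  by apply: integrable_continuous_itv => y _; exact: ck.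
have intk : \int[mu]_(y in `[a, b]) k y = 1.
  have -> : k = derive1 s by [].
  rewrite derivable_FTC2//; last by rewrite sE.
  have [] : h^-1 * (a - c) <= 0 /\ 3 <= h^-1 * (b - c).
    split; first by rewrite pmulr_rle0 ?invr_gt0//; lra.
    by rewrite mulrC ler_pdivlMr//; lra.
  by move=> /smoothstep_le0[a0 _ _] /smoothstep_ge3[b0 _ _]; rewrite /s a0 b0 subr0.
have kout y : ~~ (c <= y <= c + 3 * h) -> k y = 0.
  rewrite negb_and -!ltNge => /orP[yc|cy].
    have [|_ k0' _] := @smoothstep_le0 _ (h^-1 * (y - c)).
      by rewrite pmulr_rle0 ?invr_gt0//; lra.
    by rewrite /k k0' mulr0.
  have [|_ k0' _] := @smoothstep_ge3 _ (h^-1 * (y - c)).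
    by rewrite mulrC ler_pdivlMr//; lra.
  by rewrite /k k0' mulr0.
have ipk : mu.-integrable `[a, b] (EFin \o (fun y => phi y * k y)).
  by apply: integrable_continuous_itv => y yab; apply: cvgM; [exact: cphi|exact: ck].
have ipck : mu.-integrable `[a, b] (EFin \o (fun y => phi c * k y)).
  by apply: integrable_continuous_itv => y yab; apply: cvgM; [exact: cvg_cst|exact: ck].
have idk : mu.-integrable `[a, b] (EFin \o (fun y => phi y * k y - phi c * k y)).
  exact: (integrableB _ ipk ipck).
have -> : phi c = \int[mu]_(y in `[a, b]) (phi c * k y).
  by rewrite RintegralZl// intk mulr1.
rewrite -RintegralB//.
apply: le_trans (le_normr_Rintegral _ idk) _ => //.
have -> : e = \int[mu]_(y in `[a, b]) (e * k y) by rewrite RintegralZl// intk mulr1.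
apply: le_Rintegral => //.
- exact: (integrable_norm idk).
- by apply: integrable_continuous_itv => y yab; apply: cvgM; [exact: cvg_cst|exact: ck].
- move=> y _; rewrite -mulrBl normrM (ger0_norm (k0 y)).
  have [yin|/kout ->] := boolP (c <= y <= c + 3 * h); last by rewrite !mulr0.
  by rewrite ler_wpM2r// phie.
Qed.

Lemma cvg_scaled_harmonic (h0 : R) : h0 / n.+1%:R @[n --> \oo] --> (0 : R).
Proof.
rewrite -(mulr0 h0); apply: cvgM; first exact: cvg_cst.
exact: cvg_harmonic.
Qed.

(** At a fixed [y] the values are eventually constant, namely once the ramps are shorter than the
    distance from [y] to the knot on its left. *)
Lemma cvg_bump_indicator (h0 a b y : R) : 0 < h0 -> a < b ->
  \forall n \near \oo, bump a b (h0 / n.+1%:R) y = (a < y <= b)%R%:R.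
Proof.
move=> h00 ab.
have hn0 n : 0 < h0 / n.+1%:R by rewrite divr_gt0.
have small e : 0 < e -> \forall n \near \oo, 3 * (h0 / n.+1%:R) < e.
  move=> e0; near=> n.
  have : h0 / n.+1%:R < e / 3.
    near: n; apply: (cvgr_lt (0 : R)); first exact: cvg_scaled_harmonic.
    by rewrite divr_gt0.
  by move: (h0 / _) => t; lra.
have [ya|ay] := leP y a.
  apply: nearW => n; have [-> _ _] := bump_eq0 (hn0 n) ab (or_introl ya).
  by [].
have [yb|by_] := leP y b.
  have ya0 : 0 < y - a by rewrite subr_gt0.
  apply: filterS (small _ ya0) => n hn /=.
  rewrite /bump.
  have [|-> _ _] := @smoothstep_ge3 _ ((h0 / n.+1%:R)^-1 * (y - a)).
    by rewrite mulrC ler_pdivlMr ?hn0// ltW.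
  have [|-> _ _] := @smoothstep_le0 _ ((h0 / n.+1%:R)^-1 * (y - b)).
    by rewrite pmulr_rle0 ?invr_gt0 ?hn0// subr_le0.
  by rewrite subr0.
have yb0 : 0 < y - b by rewrite subr_gt0.
apply: filterS (small _ yb0) => n hn.
have [|-> _ _] := bump_eq0 (y := y) (hn0 n) ab; first by right; move: hn; move: (h0 / _) => t; lra.
by [].
Unshelve. all: by end_near. Qed.

Lemma cvg_Rintegral_bump (w : R -> R) (l r h0 a b : R) :
  mu.-integrable `]l, r[ (EFin \o w) -> 0 < h0 -> l < a -> a < b -> b < r ->
  \int[mu]_(y in `]l, r[) (w y * bump a b (h0 / n.+1%:R) y) @[n --> \oo] -->
  \int[mu]_(y in `[a, b]) w y.
Proof.
move=> iw h00 la ab br.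
have [mw _] := integrableP _ _ _ iw; move/measurable_EFinP : mw => mw.
have mb n : measurable_fun `]l, r[ (bump a b (h0 / n.+1%:R)).
  apply: measurable_funTS; apply: continuous_measurable_fun.
  by have [[db _ _] _ _] := bumpP a b (h0 / n.+1%:R); exact: derivable_continuous.
pose F n (y : R) := (w y * bump a b (h0 / n.+1%:R) y)%:E.
pose G (y : R) := (w y * (a < y <= b)%R%:R)%:E.
have mF n : measurable_fun `]l, r[ (F n).
  by apply/measurable_EFinP; exact: (measurable_funM mw (mb n)).
have FG (y : R) : `]l, r[%classic y -> F n y @[n --> \oo] --> G y.
  move=> _; apply: cvg_near_cst; have := cvg_bump_indicator y h00 ab.
  apply: filterS => n bn; congr EFin; congr (w y * _); exact: bn.
have [] := @dominated_convergence _ _ R mu `]l, r[%classic (measurable_itv _)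
  F G (abse \o (EFin \o w)).
- exact: mF.
- exact: (emeasurable_fun_cvg F).
- by apply: aeW => y yD; exact: FG.
- exact: integrable_abse.
- apply: aeW => y n _ /=; rewrite lee_fin normrM ler_piMr//.
  exact: bump_norm_le1.
move=> iG _ cvgF.
have GE : \int[mu]_(y in `[a, b]) w y = fine (\int[mu]_(y in `]l, r[) G y)%E.
  transitivity (\int[mu]_(y in `]l, r[) (w y * (a < y <= b)%R%:R)); last by [].
  rewrite [RHS](@Rintegral_supported _ `]a, b]).
  - rewrite -Rintegral_itv_obnd_cbnd.
      by apply: eq_Rintegral => y; rewrite inE/= in_itv/= => ->; rewrite mulr1.
    apply: integrableS iw; [exact: measurable_itv|exact: measurable_itv|].
    move=> y /=; rewrite !in_itv/= => /andP[ay yb].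
    by rewrite (lt_trans la ay) (le_lt_trans yb br).
  - move=> y /=; rewrite !in_itv/= => /andP[ay yb].
    by rewrite (lt_trans la ay) (le_lt_trans yb br).
  - by move=> y _ /=; rewrite in_itv/= => /negP/negbTE ->; rewrite mulr0.
rewrite GE; apply: fine_cvg; rewrite fineK; first exact: cvgF.
exact: integrable_fin_num iG.
Qed.

(* As [h] tends to 0, [bump a b h] tends to the indicator of `]a, b] and its
   derivative to the difference of the Dirac masses at [a] and [b]. *)
Lemma weak_derivative_increment (phi w : R -> R) (l r : R) :
  (forall y, y \in `]l, r[%R -> {for y, continuous phi}) ->
  mu.-integrable `]l, r[ (EFin \o w) ->
  (forall a b h, l < a -> a < b -> 0 < h -> b + 3 * h < r ->
    \int[mu]_(y in `]l, r[) (w y * bump a b h y) =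
    - \int[mu]_(y in `[a, b + 3 * h]) (phi y * derive1 (bump a b h) y)) ->
  forall a b, l < a -> a <= b -> b < r ->
    phi b - phi a = \int[mu]_(t in `[a, b]) w t.
Proof.
move=> cphi iw wphi a b la + br; rewrite le_eqVlt => /predU1P[<-|ab].
  by rewrite set_itv1 Rintegral_set1 subrr.
(* The divisor 4 keeps [b + 3 h < r] for every [h <= h0]. *)
pose h0 := (r - b) / 4; have h00 : 0 < h0 by rewrite divr_gt0// subr_gt0.
have hn0 n : 0 < h0 / n.+1%:R by rewrite divr_gt0.
have hnle n : h0 / n.+1%:R <= h0 by rewrite ler_pdivrMr ?ltr0Sn// ler_peMr ?(ltW h00)// ler1n.
have cvg1 := cvg_Rintegral_bump iw h00 la ab br.
apply/esym; apply: (cvg_unique _ cvg1) => //.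
apply/cvgrPdist_le => e e0.
have close c : l < c -> c < r -> \forall n \near \oo,
    forall y, c <= y <= c + 3 * (h0 / n.+1%:R) -> `|phi y - phi c| <= e / 2.
  move=> lc cr; have cc : c \in `]l, r[%R by rewrite in_itv/= lc.
  have e20 : 0 < e / 2 by rewrite divr_gt0.
  have /cvgrPdist_le/(_ _ e20)/nbhs_ballP[d /= d0 dP] := cphi _ cc.
  near=> n => y /andP[cy yc]; rewrite distrC; apply: dP.
  have hd : 3 * (h0 / n.+1%:R) < d.
    have : h0 / n.+1%:R < d / 3.
      near: n; apply: (cvgr_lt (0 : R)); first exact: cvg_scaled_harmonic.
      by rewrite divr_gt0.
    by move: (h0 / _) => t; lra.
  by rewrite /ball/= ler0_norm ?subr_le0//; move: (h0 / _) hd yc => t; lra.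
have ca := close _ la (lt_trans ab br); have cb := close _ (lt_trans la ab) br.
near=> n.
have can : forall y, a <= y <= a + 3 * (h0 / n.+1%:R) -> `|phi y - phi a| <= e / 2.
  by near: n.
have cbn : forall y, b <= y <= b + 3 * (h0 / n.+1%:R) -> `|phi y - phi b| <= e / 2.
  by near: n.
have := hnle n; have := hn0 n; move: (h0 / _) can cbn => h can cbn hpos hle.
have br3 : b + 3 * h < r by move: hle; rewrite /h0; lra.
rewrite wphi//.
have cphiab y : a <= y <= b + 3 * h -> {for y, continuous phi}.
  by move=> /andP[ay yb]; apply: cphi; rewrite in_itv/=; apply/andP; split; lra.
have a3b : a + 3 * h <= b + 3 * h by rewrite lerD2r ltW.
have Ja := @smoothstep_delta phi a (b + 3 * h) a h _ hpos (lexx a) a3b cphiab can.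
have Jb := @smoothstep_delta phi a (b + 3 * h) b h _ hpos (ltW ab) (lexx _) cphiab cbn.
have [_ -> _] := bumpP a b h.
have ik c : mu.-integrable `[a, b + 3 * h]
    (EFin \o (fun y => phi y * (h^-1 * smoothstep1 (h^-1 * (y - c))))).
  apply: integrable_continuous_itv => y yab; apply: cvgM; first exact: cphiab.
  apply: (derivable_continuous (g := fun y => h^-1 * smoothstep1 (h^-1 * (y - c)))) => z.
  have [//] := is_deriveZ h^-1 (is_derive_affine (derive_smoothstep1 (h^-1 * (z - c)))).
under eq_Rintegral do rewrite mulrBr.
rewrite RintegralB//.
move: Ja Jb; rewrite !ler_norml => /andP[? ?] /andP[? ?].
by apply/andP; split; lra.
Unshelve. all: by end_near. Qed.

End WeakDerivative.

Section Adjoint.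
Variables (R : realType) (ell : R) (N : nat) (x : nat -> R) (kappa : 'I_N -> R -> R).
Variable nu : R.
Notation mu := (@lebesgue_measure R).
Hypothesis ell_gt0 : 0 < ell.
Hypothesis x_incr : forall j : nat, (j < N)%N -> x j < x j.+1.
Hypothesis x_period : x N = x 0%N + ell.
Hypothesis dkappa : forall j y, derivable (kappa j) y 1.
Hypothesis ckappa' : forall j, continuous (derive1 (kappa j)).
Hypothesis nu_gt0 : 0 < nu.
Hypothesis kappa_ge : forall (j : 'I_N) y, x j <= y <= x j.+1 -> nu <= kappa j y.

Let bump_family (j : 'I_N) (a b h : R) (i : 'I_N) : R -> R :=
  if i == j then bump a b h else cst 0.

Lemma twice_continuously_derivable_bump_family j a b h i : twice_continuously_derivable (bump_family j a b h i).
Proof.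
rewrite /bump_family; case: ifP => _; first by have [] := bumpP a b h.
have dcst (c : R) : (forall y : R, derivable (cst c : R -> R) y 1) /\
    derive1 (cst c : R -> R) = cst 0.
  by split=> [y|]; [exact: derivable_cst|apply/funext => y; rewrite derive1_cst].
have [d0 e0] := dcst 0.
by split; rewrite ?e0//; move=> y; exact: cvg_cst.
Qed.

Section Bump.
Variables (j : 'I_N) (a b h : R).
Hypotheses (xa : x j < a) (ab : a < b) (h0 : 0 < h) (bx : b + 3 * h < x j.+1).
Let G := bump_family j a b h.
Let u := periodic_extension ell x G.

Let bump_familyjj : G j = bump a b h.
Proof. by rewrite /G /bump_family eqxx. Qed.

Let bump_familyij i : i != j -> G i = cst 0.
Proof. by rewrite /G /bump_family => /negbTE ->. Qed.

Lemma bump_family_edge (i : 'I_N) :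
  [/\ G i (x i) = 0, G i (x i.+1) = 0, derive1 (G i) (x i) = 0 & derive1 (G i) (x i.+1) = 0].
Proof.
rewrite /G /bump_family; case: eqP => [->|_]; last by rewrite !derive1_cst.
have [-> -> _] := @bump_eq0 _ a b h (x j) h0 ab (or_introl (ltW xa)).
by have [-> -> _] := @bump_eq0 _ a b h (x j.+1) h0 ab (or_intror (ltW bx)).
Qed.

Lemma domL_bump (gamma theta : R) : domL ell x kappa gamma theta u.
Proof.
have G2 := twice_continuously_derivable_bump_family j a b h.
have edge := bump_family_edge.
apply: domL_periodic_extension => //.
have [_ _ uL uR [fL fR]] := periodic_extension_edges ell_gt0 x_incr x_period dkappa G2.
move=> i; rewrite uL uR fL fR /flux -/G.
have [-> -> -> ->] := edge i; have [-> _ -> _] := edge (ordS i).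
have [_ -> _ ->] := edge (ord_pred i).
by rewrite !mulr0 oppr0; split; ring.
Qed.

Lemma inner_bump_l (v : R -> R) :
  inner N x v u = \int[mu]_(y in `]x j, x j.+1[) (v y * bump a b h y).
Proof.
have uE := periodic_extensionE ell_gt0 x_incr x_period G.
rewrite /inner (bigD1 j)//= big1 ?addr0.
  by apply: eq_Rintegral => y; rewrite inE => yj; rewrite /u (uE _ _ yj) bump_familyjj.
move=> i ij; transitivity (\int[mu]_(y in [set` elt x i]) (0 : R)).
  by apply: eq_Rintegral => y; rewrite inE => yi; rewrite /u (uE _ _ yi) bump_familyij// mulr0.
by rewrite Rintegral_cst ?mul0r.
Qed.

Lemma inner_Lop_bump (v : R -> R) :
  inner N x v (Lop x kappa u) = \int[mu]_(y in `]x j, x j.+1[)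
    (v y * derive1 (fun z => kappa j z * derive1 (bump a b h) z) y).
Proof.
have LE := Lop_periodic_extension kappa ell_gt0 x_incr x_period G.
rewrite (inner_LopE kappa x_incr) (bigD1 j)//= big1 ?addr0.
  apply: eq_Rintegral => y; rewrite inE => yj.
  by rewrite /u (LE _ _ yj) bump_familyjj.
move=> i ij; transitivity (\int[mu]_(y in [set` elt x i]) (0 : R)).
  apply: eq_Rintegral => y; rewrite inE => yi.
  rewrite /u (LE _ _ yi) bump_familyij//.
  rewrite (_ : (fun z => _) = cst 0) ?derive1_cst ?mulr0//.
  by apply/funext => z; rewrite derive1_cst mulr0.
by rewrite Rintegral_cst ?mul0r.
Qed.

(** Only one derivative is moved onto [v], so the result tests [kappa v'] against the derivative of
    the bump, as [weak_derivative_increment] expects. All integrands are continuous on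
    [[a, b + 3 h]], a compact part of the element, and the boundary terms vanish with the slope of
    the bump. *)
Lemma bump_by_parts (v : R -> R) : twice_differentiable N x v ->
  \int[mu]_(y in `]x j, x j.+1[)
    (v y * derive1 (fun z => kappa j z * derive1 (bump a b h) z) y) =
  - \int[mu]_(y in `[a, b + 3 * h])
     (kappa j y * derive1 v y * derive1 (bump a b h) y).
Proof.
move=> dv; have [dg dg' cg''] : twice_continuously_derivable (bump a b h) by have [] := bumpP a b h.
have inx y : a <= y <= b + 3 * h -> y \in elt x j.
  by move=> /andP[ay yb]; rewrite in_itv/= (lt_le_trans xa ay) (le_lt_trans yb bx).
set g := bump a b h in dg dg' cg'' *.
have dk y := derive1_mul (@dkappa j y) (dg' y).
have dvk y : a <= y <= b + 3 * h ->
    derivable (fun z => v z * (kappa j z * derive1 g z)) y 1 /\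
    derive1 (fun z => v z * (kappa j z * derive1 g z)) y =
      v y * derive1 (fun z => kappa j z * derive1 g z) y + kappa j y * derive1 v y * derive1 g y.
  move=> yab; have [dvy _] := dv j y (inx _ yab).
  have [dm ->] := derive1_mul dvy (dk y).1; split; first exact: dm.
  by rewrite mulrAC.
rewrite (@Rintegral_supported _ _ `[a, b + 3 * h]); first last.
- move=> y _; rewrite /= in_itv/= => /negP; rewrite negb_and -!ltNge => yab.
  have [_ g1 g2] : [/\ g y = 0, derive1 g y = 0 & derive1 (derive1 g) y = 0].
    by apply: bump_eq0 => //; case/orP: yab => /ltW; [left|right].
  by rewrite (dk y).2 g1 g2 !(mulr0, mul0r) addr0 mulr0.
- by move=> y /=; rewrite in_itv/= => /inx.
have cv y : a <= y <= b + 3 * h -> {for y, continuous v}.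
  move=> /inx/(dv j)[dvy _].
  by apply: differentiable_continuous; apply/derivable1_diffP.
have cv' y : a <= y <= b + 3 * h -> {for y, continuous (derive1 v)}.
  move=> /inx/(dv j)[_ dvy].
  by apply: differentiable_continuous; apply/derivable1_diffP.
have ck := derivable_continuous (@dkappa j).
have cg' := derivable_continuous dg'.
have i1 : mu.-integrable `[a, b + 3 * h]
    (EFin \o (fun y => v y * derive1 (fun z => kappa j z * derive1 g z) y)).
  apply: integrable_continuous_itv => y yab; apply: cvgM; first exact: cv.
  have -> : derive1 (fun z => kappa j z * derive1 g z) =
    (fun y => kappa j y * derive1 (derive1 g) y + derive1 g y * derive1 (kappa j) y).
    by apply/funext => z; rewrite (dk z).2.
  apply: cvgD; apply: cvgM; [exact: ck|exact: cg''|exact: cg'|exact: ckappa'].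
have i2 : mu.-integrable `[a, b + 3 * h]
    (EFin \o (fun y => kappa j y * derive1 v y * derive1 g y)).
  apply: integrable_continuous_itv => y yab; apply: cvgM; last exact: cg'.
  by apply: cvgM; [exact: ck|exact: cv'].
apply/eqP; rewrite -addr_eq0 -RintegralD//; apply/eqP.
have ab3 : a <= b + 3 * h by rewrite (le_trans (ltW ab))// lerDl mulr_ge0// ltW.
transitivity (\int[mu]_(y in `[a, b + 3 * h]) derive1 (fun z => v z * (kappa j z * derive1 g z)) y).
  by apply: eq_Rintegral => y; rewrite inE/= in_itv/= => yab; rewrite (dvk _ yab).2.
rewrite (derivable_FTC2 ab3).
- have [_ -> _] := @bump_eq0 _ a b h (b + 3 * h) h0 ab (or_intror (lexx _)).
  have [_ -> _] := @bump_eq0 _ a b h a h0 ab (or_introl (lexx _)).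
  by rewrite !mulr0 subr0.
- by move=> y /dvk[].
- apply: eq_integrable (integrableD _ i1 i2) => //.
  by move=> y; rewrite inE/= in_itv/= => yab; rewrite (dvk _ yab).2.
Qed.

End Bump.

(** Bumps lie in the domain for all parameters, their edge data being zero, so the adjoint identity
    says that [w] is the weak derivative of the continuous function [kappa v']. The rest follows
    from the resulting increment formula. *)
Lemma adjoint_regularity (gamma theta : R) (v w : R -> R) :
  LL ell N x v -> square_integrable N x w ->
  (forall u, domL ell x kappa gamma theta u ->
     inner N x v (Lop x kappa u) = inner N x w u) ->
  [/\ square_integrable N x (Lop x kappa v), has_edge_values x (fun _ : 'I_N => v),
      has_edge_values x (flux kappa v) &
      forall j : 'I_N, {ae mu, forall y, y \in elt x j -> Lop x kappa v y = w y}].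
Proof.
move=> [_ v2 dv] w2 adj.
have iw (j : 'I_N) : mu.-integrable `]x j, x j.+1[ (EFin \o w) := L2on_integrable (w2 j).
pose phi (j : 'I_N) z := kappa j z * derive1 v z.
have dphi j y : y \in elt x j -> derivable (phi j) y 1.
  move=> yj; have [_ dvy] := dv j y yj.
  by have [] := derive1_mul (@dkappa j y) dvy.
have incr (j : 'I_N) : forall a b, x j < a -> a <= b -> b < x j.+1 ->
    phi j b - phi j a = \int[mu]_(t in `[a, b]) w t.
  apply: weak_derivative_increment => //.
  - move=> y yj; apply: differentiable_continuous; apply/derivable1_diffP.
    exact: dphi.
  - move=> a b h xa ab h0 bx.
    rewrite -(bump_by_parts xa ab h0 bx dv) -inner_bump_l//.
    rewrite -(inner_Lop_bump _ _ _ _ v); apply/esym/adj.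
    exact: domL_bump.
have xj (j : 'I_N) : x j < x j.+1 by exact: x_incr.
have aeE (j : 'I_N) := increment_integral_derive1 (xj j) (iw j) (incr j).
have cphi (j : 'I_N) := increment_integral_cvg (xj j) (iw j) (incr j).
have iphi (j : 'I_N) := increment_integral_integrable (xj j) (iw j) (incr j).
split.
- apply/square_integrable_Lop => // j; apply: L2on_ae_eq (aeE j) (w2 j).
  by apply: measurable_derive1_oo => y; exact: dphi.
- move=> j.
  (* Here ellipticity enters: [|v'| <= nu^-1 |kappa v'|], and the right-hand side is integrable. *)
  have iv' : mu.-integrable `]x j, x j.+1[ (EFin \o (derive1 v)).
    have iz : mu.-integrable `]x j, x j.+1[ (fun y => (nu^-1)%:E * (phi j y)%:E)%E.
      by apply: integrableZl (iphi j); exact: measurable_itv.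
    apply: le_integrable iz; first exact: measurable_itv.
      apply/measurable_EFinP; apply: measurable_derive1_oo => y yj.
      by have [] := dv j y yj.
    move=> y; rewrite /= in_itv/= => /andP[xy yx].
    have kge : nu <= kappa j y by rewrite kappa_ge// !ltW.
    rewrite lee_fin /phi mulrA normrM ler_peMl// normrM.
    rewrite ger0_norm ?invr_ge0 ?(ltW nu_gt0)//.
    rewrite ger0_norm ?(le_trans (ltW nu_gt0))//.
    by rewrite mulrC ler_pdivlMr// mul1r.
  have dvj y : y \in `]x j, x j.+1[%R -> derivable v y 1.
    by move=> yj; have [] := dv j y yj.
  have [la [lb [cla clb _]]] := derivable_FTC2_oo (xj j) dvj iv'.
  by split; apply/cvg_ex; [exists la|exists lb].
- move=> j; have [la [lb [cla clb _]]] := cphi j.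
  split; apply/cvg_ex; [exists (- la)|exists (- lb)].
    exact: (cvgN cla).
  exact: (cvgN clb).
- move=> j; apply: filterS (aeE j); first exact: (ae_filter_ringOfSetsType mu).
  by move=> y yE yj; rewrite (LopE kappa x_incr v yj) yE.
Qed.

End Adjoint.

(** * The edge conditions as circulant systems *)

Section EdgeAlgebra.
Variable (R : realFieldType) (N : nat).
Implicit Types (u f uL uR fL fR : 'I_N -> R).

Lemma reindex_ord_pred (F : 'I_N -> R) : \sum_j F (ord_pred j) = \sum_j F j.
Proof. by rewrite [RHS](reindex_inj (@ord_pred_inj N)). Qed.

(** One turn around a cycle of odd length changes the sign, so [u ord0 = - u ord0]. *)
Lemma alternating_cycle_eq0 u : odd N -> (forall j, u j = - u (ord_pred j)) ->
  forall j, u j = 0.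
Proof.
case: N u => // n u oddn alt.
have uk k (kn : (k < n.+1)%N) : u (Ordinal kn) = (-1) ^+ k * u ord0.
  elim: k kn => [|k IHk] kn.
    by rewrite expr0 mul1r; congr u; apply: val_inj.
  rewrite alt (_ : ord_pred _ = Ordinal (ltnW kn)) ?IHk ?exprS ?mulN1r ?mulNr//.
  by apply: val_inj; rewrite /= modnDr modn_small// ltnW.
have u0 : u ord0 = 0.
  have := alt ord0; rewrite (_ : ord_pred _ = Ordinal (ltnSn n)).
    by rewrite uk -signr_odd; move: oddn => /= /negbTE ->; rewrite expr0; lra.
  by apply: val_inj; rewrite /= modn_small.
by case=> k kn; rewrite uk u0 mulr0.
Qed.

(** Taking absolute values and summing over the cycle gives [|1 - p| S = |p| S] with [S] the sum of
    the [|u j|]. Either [S = 0], or [p = 1/2] and [u] alternates in sign. *)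
Lemma cycle_kernel_eq0 (p : R) u : ~ (~~ odd N /\ p = 2^-1) ->
  (forall j, (1 - p) * u j + p * u (ord_pred j) = 0) -> forall j, u j = 0.
Proof.
move=> Np up.
have up' j : `|1 - p| * `|u j| = `|p| * `|u (ord_pred j)|.
  by rewrite -!normrM; have /eqP := up j; rewrite addr_eq0 => /eqP ->; rewrite normrN.
have : `|1 - p| * (\sum_j `|u j|) = `|p| * \sum_j `|u j|.
  rewrite -[in RHS](reindex_ord_pred (fun j => `|u j|)) !mulr_sumr.
  by apply: eq_bigr => j _; exact: up'.
set S := \sum_j _ => /eqP; rewrite -subr_eq0 -mulrBl mulf_eq0.
case/orP => [|/eqP S0 j]; last first.
  apply/eqP; rewrite -normr_eq0; apply/eqP.
  exact: (psumr_eq0P (fun i _ => normr_ge0 (u i)) S0).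
rewrite subr_eq0 eqr_norm2 => /orP[/eqP|/eqP] p1; last lra.
have p2 : p = 2^-1 by lra.
apply: alternating_cycle_eq0 => [|j].
  by apply/negPn/negP => evenN; apply: Np.
by have := up j; rewrite p2; lra.
Qed.

Definition shift_mx : 'M[R]_N := \matrix_(i, j) (i == ord_pred j)%:R.

Lemma mul_shift_mx (r : 'rV[R]_N) j : (r *m shift_mx) 0 j = r 0 (ord_pred j).
Proof.
rewrite mxE (bigD1 (ord_pred j))//= mxE eqxx mulr1 big1 ?addr0// => i ij.
by rewrite mxE (negbTE ij) mulr0.
Qed.

Lemma mul_shift_mxT (r : 'rV[R]_N) j : (r *m shift_mx^T) 0 j = r 0 (ordS j).
Proof.
rewrite mxE (bigD1 (ordS j))//= !mxE ordSK eqxx mulr1 big1 ?addr0// => i ij.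
by rewrite !mxE -(inj_eq (@ordS_inj N)) ord_predK eq_sym (negbTE ij) mulr0.
Qed.

Lemma shift_mx_comm : shift_mx *m shift_mx^T = shift_mx^T *m shift_mx.
Proof.
apply/row_matrixP => i; rewrite !row_mul; apply/rowP => j.
by rewrite mul_shift_mxT mul_shift_mx !mxE ordSK (inj_eq (@ord_pred_inj N)) eq_sym.
Qed.

Definition cycle_mx (p : R) : 'M[R]_N := (1 - p)%:M + p *: shift_mx.

Lemma mul_cycle_mx p (r : 'rV[R]_N) j :
  (r *m cycle_mx p) 0 j = (1 - p) * r 0 j + p * r 0 (ord_pred j).
Proof. by rewrite mulmxDr mxE mul_mx_scalar -scalemxAr !mxE -mul_shift_mx mxE. Qed.

Lemma mul_cycle_mxT p (r : 'rV[R]_N) j :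
  (r *m (cycle_mx p)^T) 0 j = (1 - p) * r 0 j + p * r 0 (ordS j).
Proof.
rewrite linearD/= tr_scalar_mx linearZ/= mulmxDr mxE mul_mx_scalar -scalemxAr !mxE.
by rewrite -mul_shift_mxT mxE.
Qed.

Lemma cycle_mx_comm p q : cycle_mx p *m (cycle_mx q)^T = (cycle_mx q)^T *m cycle_mx p.
Proof.
rewrite /cycle_mx linearD/= tr_scalar_mx linearZ/=.
rewrite !mulmxDl !mulmxDr !mul_scalar_mx !mul_mx_scalar -!scalemxAr -!scalemxAl.
rewrite shift_mx_comm !scalerA !scale_scalar_mx.
rewrite [q * p]mulrC [(1 - p) * (1 - q)]mulrC [(1 - q) * p]mulrC [(1 - p) * q]mulrC.
by rewrite -!addrA; congr (_ + _); rewrite addrCA.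
Qed.

Lemma cycle_mx_unit p : ~ (~~ odd N /\ p = 2^-1) -> cycle_mx p \in unitmx.
Proof.
move=> Np; rewrite -row_free_unit; apply: inj_row_free => r r0.
apply/rowP => j; rewrite [RHS]mxE.
apply: (cycle_kernel_eq0 Np (u := fun j => r 0 j)) => k.
by rewrite -mul_cycle_mx r0 mxE.
Qed.

(* With [p = gamma (1 + theta) / 2] and [q = gamma (1 - theta) / 2], the
   conditions on [u] read [A uR = B uL] and those on [f] read [B^T fR = A^T fL],
   where [A] and [B] are commuting circulant matrices. *)
Definition coupling (p q : R) uL uR := forall j,
  (1 - p) * uR j + p * uR (ord_pred j) = (1 - q) * uL j + q * uL (ordS j).

(** Write [A = cycle_mx p] and [B = (cycle_mx q)^T], acting on rows from the right. If [A] is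
    invertible, the two sums are [uL B A^-1 fR^T] and [uL A^-1 B fR^T], equal by commutation;
    otherwise [B] is invertible and the roles are exchanged. *)
Lemma coupling_orthogonal p q uL uR fL fR :
  ~ [/\ ~~ odd N, p = 2^-1 & q = 2^-1] ->
  coupling p q uL uR -> coupling q p fL fR ->
  \sum_j uR j * fR j = \sum_j uL j * fL j.
Proof.
move=> Npq cu cf.
pose row (g : 'I_N -> R) : 'rV[R]_N := \row_j g j.
have dot (g h : 'I_N -> R) : \sum_j g j * h j = (row g *m (row h)^T) 0 0.
  by rewrite mxE; apply: eq_bigr => j _; rewrite !mxE.
have Au : row uR *m cycle_mx p = row uL *m (cycle_mx q)^T.
  by apply/rowP => j; rewrite mul_cycle_mx mul_cycle_mxT !mxE cu.
have Af : row fR *m cycle_mx q = row fL *m (cycle_mx p)^T.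
  by apply/rowP => j; rewrite mul_cycle_mx mul_cycle_mxT !mxE cf.
have AfT : (cycle_mx q)^T *m (row fR)^T = cycle_mx p *m (row fL)^T.
  by rewrite -trmx_mul Af trmx_mul trmxK.
rewrite !dot; congr ((_ : 'M[R]_1) 0 0).
have comm := cycle_mx_comm p q.
have [Ap|nAp] := boolP (cycle_mx p \in unitmx).
  have -> : row uR = row uL *m ((cycle_mx q)^T *m invmx (cycle_mx p)).
    by rewrite mulmxA -Au mulmxK.
  have -> : (row fL)^T = invmx (cycle_mx p) *m ((cycle_mx q)^T *m (row fR)^T).
    by rewrite AfT mulKmx.
  rewrite -!mulmxA; congr (_ *m _); rewrite !mulmxA; congr (_ *m _).
  by rewrite -[LHS](mulKmx Ap) (mulmxA (cycle_mx p)) comm -!mulmxA mulmxV// mulmx1.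
have Bq : (cycle_mx q)^T \in unitmx.
  rewrite unitmx_tr; apply: cycle_mx_unit => -[evenN q2].
  by case/negP: nAp; apply: cycle_mx_unit => -[_ p2]; apply: Npq.
have -> : row uL = row uR *m (cycle_mx p *m invmx (cycle_mx q)^T).
  by rewrite mulmxA Au mulmxK.
have -> : (row fR)^T = invmx (cycle_mx q)^T *m (cycle_mx p *m (row fL)^T).
  by rewrite -AfT mulKmx.
rewrite -!mulmxA; congr (_ *m _); rewrite !mulmxA; congr (_ *m _).
by rewrite -[RHS](mulKmx Bq) (mulmxA (cycle_mx q)^T) -comm -!mulmxA mulmxV// mulmx1.
Qed.

Lemma coupling0 p q : coupling p q (fun=> 0) (fun=> 0).
Proof. by move=> j; rewrite !mulr0. Qed.

(* The test data are the coefficients of the [k]-th condition on [v]. *)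
Lemma coupling_dual p q vL vR :
  (forall fL fR, coupling q p fL fR -> \sum_j vR j * fR j = \sum_j vL j * fL j) ->
  coupling p q vL vR.
Proof.
move=> ortho k.
pose fR j := (1 - p) * (j == k)%:R + p * (j == ord_pred k)%:R : R.
pose fL j := (1 - q) * (j == k)%:R + q * (j == ordS k)%:R : R.
have delta (g : 'I_N -> R) i : \sum_j g j * (j == i)%:R = g i.
  rewrite (bigD1 i)//= eqxx mulr1 big1 ?addr0// => j ji.
  by rewrite (negbTE ji) mulr0.
have expand (g : 'I_N -> R) c i1 d i2 :
    \sum_j g j * (c * (j == i1)%:R + d * (j == i2)%:R) = c * g i1 + d * g i2.
  rewrite -(delta g i1) -(delta g i2) !mulr_sumr -big_split/=.
  by apply: eq_bigr => j _; ring.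
(* What remains is that the test data are themselves coupled, which is the commutation of the two
   circulants, read entrywise. *)
have := ortho fL fR; rewrite !expand; apply => j.
rewrite /fR /fL.
rewrite (inj_eq (@ord_pred_inj N)) (inj_eq (@ordS_inj N)).
rewrite (can2_eq (@ord_predK N) (@ordSK N)) [ordS j == k](can2_eq (@ordSK N) (@ord_predK N)).
ring.
Qed.

End EdgeAlgebra.

(** * Self-adjointness, and its failure in the exceptional case *)

Section SelfAdjoint.
Variables (R : realType) (ell : R) (N : nat) (x : nat -> R) (kappa : 'I_N -> R -> R).
Variable nu : R.
Notation mu := (@lebesgue_measure R).
Hypothesis ell_gt0 : 0 < ell.
Hypothesis N_gt0 : (0 < N)%N.
Hypothesis x_incr : forall j : nat, (j < N)%N -> x j < x j.+1.
Hypothesis x_period : x N = x 0%N + ell.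
Hypothesis dkappa : forall j y, derivable (kappa j) y 1.
Hypothesis ckappa' : forall j, continuous (derive1 (kappa j)).
Hypothesis nu_gt0 : 0 < nu.
Hypothesis kappa_ge : forall (j : 'I_N) y, x j <= y <= x j.+1 -> nu <= kappa j y.

Let uL (u : R -> R) := edgeL x (fun _ : 'I_N => u).
Let uR (u : R -> R) := edgeR x (fun _ : 'I_N => u).
Let fL (u : R -> R) := edgeL x (flux kappa u).
Let fR (u : R -> R) := edgeR x (flux kappa u).

(** The condition on fluxes is the one on values with [theta] negated, which exchanges [p] and
    [q]. *)
Lemma edge_conditionsP (gamma theta : R) (u : R -> R) :
  let p := gamma / 2 * (1 + theta) in let q := gamma / 2 * (1 - theta) in
  edge_conditions x kappa gamma theta u <->
  coupling p q (uL u) (uR u) /\ coupling q p (fL u) (fR u).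
Proof.
move=> p q; rewrite /edge_conditions -/(uL u) -/(uR u) -/(fL u) -/(fR u) /coupling.
split=> [ec|[cu cf] j].
  split=> j; have [e1 e2] := ec j; rewrite /p /q.
    by move: (uL u j) (uR u j) (uL u _) (uR u _) e1 => *; lra.
  by move: (fL u j) (fR u j) (fL u _) (fR u _) e2 => *; lra.
move: (cu j) (cf j); rewrite /p /q.
move: (uL u j) (uR u j) (uL u _) (uR u _) (fL u j) (fR u j) (fL u _) (fR u _).
by move=> *; split; lra.
Qed.

(** As [kappa] does not vanish at the nodes, prescribed fluxes amount to prescribed slopes, and a
    cubic on each element takes any values and slopes at its two ends. *)
Lemma exists_domL_edges (gamma theta : R) (a b c d : 'I_N -> R) :
  let p := gamma / 2 * (1 + theta) in let q := gamma / 2 * (1 - theta) in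
  coupling p q a b -> coupling q p c d ->
  exists2 u, domL ell x kappa gamma theta u &
    [/\ uL u = a, uR u = b, fL u = c & fR u = d].
Proof.
move=> p q cab ccd.
have /choice[G GP] (j : 'I_N) := exists_hermite_interpolant (a j) (b j)
  (- c j / kappa j (x j)) (- d j / kappa j (x j.+1)) (x_incr (ltn_ord j)).
have G2 j := (GP j).1.
have kx (j : 'I_N) : kappa j (x j) != 0 /\ kappa j (x j.+1) != 0.
  have xj := ltW (x_incr (ltn_ord j)).
  by split; rewrite gt_eqF// (lt_le_trans nu_gt0)// kappa_ge// lexx xj.
have [_ _ eL eR [eFL eFR]] := periodic_extension_edges ell_gt0 x_incr x_period dkappa G2.
have uE : [/\ uL (periodic_extension ell x G) = a, uR (periodic_extension ell x G) = b,
    fL (periodic_extension ell x G) = c & fR (periodic_extension ell x G) = d].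
  split; rewrite /uL /uR /fL /fR ?eL ?eR ?eFL ?eFR; apply/funext => j;
    have [_ [Ga Gb Ga' Gb']] := GP j => //; rewrite /flux; have [k1 k2] := kx j.
  - by rewrite Ga' mulrC divfK// opprK.
  - by rewrite Gb' mulrC divfK// opprK.
exists (periodic_extension ell x G) => //.
apply: (domL_periodic_extension ell_gt0 x_incr x_period dkappa ckappa' G2).
by apply/edge_conditionsP; have [-> -> -> ->] := uE.
Qed.

Lemma inner_ae_eq (v w u : R -> R) : square_integrable N x v ->
  square_integrable N x w -> square_integrable N x u ->
  (forall j : 'I_N, {ae mu, forall y, y \in elt x j -> v y = w y}) ->
  inner N x v u = inner N x w u.
Proof.
move=> v2 w2 u2 vw; apply: eq_bigr => j _; congr fine.
have mvu (g : R -> R) : measurable_fun [set` elt x j] g ->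
    measurable_fun [set` elt x j] (fun y => (g y * u y)%:E).
  by move=> mg; apply/measurable_EFinP; exact: (measurable_funM mg (u2 j).1).
apply: ae_eq_integral; [exact: measurable_itv|exact: mvu (v2 j).1|exact: mvu (w2 j).1|].
apply: filterS (vw j); first exact: (ae_filter_ringOfSetsType mu).
by move=> y vwy yj; rewrite vwy.
Qed.

(** Asymmetric in [u] and [v], because the edge conditions on [v] are to be deduced from this
    identity. *)
Lemma domL_green (gamma theta : R) (u v : R -> R) :
  domL ell x kappa gamma theta u -> LL ell N x v ->
  square_integrable N x (Lop x kappa v) -> has_edge_values x (fun _ : 'I_N => v) ->
  has_edge_values x (flux kappa v) ->
  inner N x v (Lop x kappa u) - inner N x (Lop x kappa v) u =
  \sum_(j < N) (uR u j * fR v j - uL u j * fL v j)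
  - \sum_(j < N) (uR v j * fR u j - uL v j * fL u j).
Proof.
move=> [[_ u2 du] Au2 eu efu _] [_ v2 dv] Av2 ev efv.
exact: inner_Lop_green.
Qed.

Lemma self_adjoint_of_nonexceptional (gamma theta : R) :
  ~ [/\ ~~ odd N, gamma = 1 & theta = 0] ->
  self_adjoint ell N x (domL ell x kappa gamma theta) (Lop x kappa).
Proof.
move=> nex v w LLv w2; set p := gamma / 2 * (1 + theta); set q := gamma / 2 * (1 - theta).
have npq : ~ [/\ ~~ odd N, p = 2^-1 & q = 2^-1].
  case=> evenN p2 q2; apply: nex; split => //.
    by move: p2 q2; rewrite /p /q; lra.
  have g1 : gamma = 1 by move: p2 q2; rewrite /p /q; lra.
  by move: p2; rewrite /p g1; lra.
have nqp : ~ [/\ ~~ odd N, q = 2^-1 & p = 2^-1] by case=> *; apply: npq.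
have v2 : square_integrable N x v by case: LLv.
split=> [adj|[[_ Av2 ev efv /edge_conditionsP[cv cfv]] Avw] u du].
  have [Av2 ev efv aevw] := adjoint_regularity ell_gt0 x_incr x_period dkappa
    ckappa' nu_gt0 kappa_ge LLv w2 adj.
  split; last exact: aevw.
  have green0 u : domL ell x kappa gamma theta u ->
      \sum_(j < N) (uR u j * fR v j - uL u j * fL v j) =
      \sum_(j < N) (uR v j * fR u j - uL v j * fL u j).
    move=> du; apply/eqP; rewrite -subr_eq0 -(domL_green du LLv Av2 ev efv).
    rewrite adj//; have u2 : square_integrable N x u by case: du => [[]].
    by rewrite (inner_ae_eq Av2 w2 u2 aevw) subrr.
  (* Fields [u] with zero edge values and arbitrary coupled fluxes isolate the edge values of [v];
     fields with zero edge fluxes isolate its fluxes. *)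
  split => //; apply/edge_conditionsP; split; apply: coupling_dual => a b cab.
    have [u du [eL eR eFL eFR]] :=
      exists_domL_edges (coupling0 _ _ : coupling p q (fun=> 0) (fun=> 0)) cab.
    have := green0 u du; rewrite eL eR eFL eFR.
    rewrite big1 => [|j _]; last by rewrite !mul0r subrr.
    by rewrite sumrB => /esym/eqP; rewrite subr_eq0 => /eqP.
  have [u du [eL eR eFL eFR]] :=
    exists_domL_edges cab (coupling0 _ _ : coupling q p (fun=> 0) (fun=> 0)).
  have := green0 u du; rewrite eL eR eFL eFR.
  rewrite [RHS]big1 => [|j _]; last by rewrite !mulr0 subrr.
  rewrite sumrB => /eqP; rewrite subr_eq0 => /eqP.
  by under eq_bigr do rewrite mulrC; under [RHS]eq_bigr do rewrite mulrC.
have u2 : square_integrable N x u by case: du => [[]].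
rewrite -(inner_ae_eq Av2 w2 u2 Avw).
apply/eqP; rewrite -subr_eq0 (domL_green du LLv Av2 ev efv).
have [cu cfu] : coupling p q (uL u) (uR u) /\ coupling q p (fL u) (fR u).
  by case: du => _ _ _ _ /edge_conditionsP.
have e1 := coupling_orthogonal npq cu cfv.
have e2 := coupling_orthogonal npq cv cfu.
move: e1 e2; move: (uR u) (uL u) (fR u) (fL u) (uR v) (uL v) (fR v) (fL v).
by move=> ? ? ? ? ? ? ? ? e1 e2; rewrite !sumrB e1 e2 !subrr.
Qed.

(** For [p = q = 1/2] the alternating vector on right edges is coupled with zero on left edges.
    Giving these values to [u] with zero fluxes, and these fluxes to [v] with zero values, makes the
    boundary term a sum of [N] squares of signs, that is [N], although both fields are in the
    domain. *)
Lemma exceptional_not_self_adjoint : ~~ odd N ->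
  ~ self_adjoint ell N x (domL ell x kappa 1 0) (Lop x kappa).
Proof.
move=> evenN sa; pose alt (j : 'I_N) : R := (-1) ^+ j.
set p : R := 1 / 2 * (1 + 0); set q : R := 1 / 2 * (1 - 0).
have altpred j : alt (ord_pred j) = - alt j.
  rewrite /alt; case: j => -[|k] kN /=.
    rewrite add0n modn_small ?prednK// -signr_odd.
    by move: evenN; rewrite -[in odd N](prednK N_gt0) /= negbK => ->.
  by rewrite modnDr modn_small 1?ltnW// exprS mulN1r opprK.
have calt (a b : R) : a = 1 / 2 -> b = 1 / 2 -> coupling a b (fun=> 0) alt.
  by move=> -> -> j; rewrite altpred; lra.
have p2 : p = 1 / 2 by rewrite /p; lra.
have q2 : q = 1 / 2 by rewrite /q; lra.
have [u du [uLE uRE ufLE ufRE]] := exists_domL_edges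
  (calt p q p2 q2)
  (coupling0 _ _ : coupling q p (fun=> 0) (fun=> 0)).
have [v dv [vLE vRE vfLE vfRE]] := exists_domL_edges
  (coupling0 _ _ : coupling p q (fun=> 0) (fun=> 0))
  (calt q p q2 p2).
have [LLv Av2 ev efv _] := dv.
have [_ /(_ (conj dv _))] := sa v (Lop x kappa v) LLv Av2.
move=> /(_ (fun j => aeW _ (fun y _ => erefl)) u du) /eqP.
rewrite -subr_eq0 (domL_green du LLv Av2 ev efv) uLE uRE ufLE ufRE vLE vRE vfLE vfRE.
rewrite [X in _ - X]big1 => [|j _]; last by rewrite !mul0r subrr.
rewrite subr0 (eq_bigr (fun=> 1)) => [|j _].
  by rewrite sumr_const card_ord pnatr_eq0 => /eqP N0; move: N_gt0; rewrite N0.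
by rewrite mul0r subr0 /alt -expr2 sqrr_sign.
Qed.

End SelfAdjoint.

Theorem mainTheorem5 (R : realType) (ell : R) (N : nat) (x : nat -> R)
    (f : R * R * R -> R) (nu : R) (U : 'I_N -> R)
    (ell_gt0 : 0 < ell) (N_gt0 : (0 < N)%N)
    (x_incr : forall j : nat, (j < N)%N -> x j < x j.+1)
    (x_period : x N = x 0%N + ell)
    (f_smooth : smooth f) (nu_gt0 : 0 < nu)
    (f_ux : forall y u p : R, y \in `[x 0%N, x N]%R -> d_ux f (y, u, p) <= - nu)
    (f_ux0 : forall y u : R, y \in `[x 0%N, x N]%R -> f (y, u, 0) = 0) :
  let kappa := diffusivity f U in
  let L_self_adjoint (gamma theta : R) :=
    self_adjoint ell N x (domL ell x kappa gamma theta) (Lop x kappa) in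
  {ae (@lebesgue_measure R \x @lebesgue_measure R)%E,
    forall p : R * R, L_self_adjoint p.1 p.2} /\
  (forall gamma theta : R,
    L_self_adjoint gamma theta <-> ~ [/\ ~~ odd N, gamma = 1 & theta = 0]).
Proof.
move=> kappa L_self_adjoint.
have dkappa j y : derivable (kappa j) y 1 by exact: (diffusivityP U j f_smooth).1.
have ckappa' j : continuous (derive1 (kappa j)) by exact: (diffusivityP U j f_smooth).2.
have kappa_ge (j : 'I_N) y : x j <= y <= x j.+1 -> nu <= kappa j y.
  move=> /andP[jy yj]; rewrite /kappa /diffusivity lerNr; apply: f_ux.
  rewrite in_itv/=; apply/andP; split.
    by apply: le_trans jy; apply: (node_le x_incr) => //; exact: ltnW.
  by apply: (le_trans yj); apply: (node_le x_incr).
have nonexceptional gamma theta : ~ [/\ ~~ odd N, gamma = 1 & theta = 0] ->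
    L_self_adjoint gamma theta.
  exact: (self_adjoint_of_nonexceptional ell_gt0 x_incr x_period dkappa ckappa'
    nu_gt0 kappa_ge).
split; last first.
  move=> gamma theta; split=> [sa [evenN g1 t0]|]; last exact: nonexceptional.
  move: sa; rewrite g1 t0.
  exact: (exceptional_not_self_adjoint ell_gt0 N_gt0 x_incr x_period dkappa ckappa'
    nu_gt0 kappa_ge evenN).
(* Whatever the parity of [N], the failures lie in the single point [(1, 0)], a null set of the
   plane. *)
exists ([set 1] `*` [set 0]); split.
- by apply: measurableX; exact: measurable_set1.
- rewrite product_measure1E; [|exact: measurable_set1|exact: measurable_set1].
  rewrite [X in (X * _)%E](_ : _ = 0%E); first by rewrite mul0e.
  exact: lebesgue_measure_set1.
- move=> [gamma theta] /= nsa; apply: contrapT => ne; apply: nsa.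
  by apply: nonexceptional => -[_ g1 t0]; apply: ne.
Qed.
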